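(* Let $k$ be an algebraically closed field, let $A$ be a finite-dimensional $k$-algebra, let $\Gamma$ be a connected component of the Auslander-Reiten quiver of $A$ which is mesh-comparable via $F$, and let $f:X\to Y$ be a morphism between modules of $\Gamma$. Then there exists a decomposition (with finite support) $$f=f_0+f_1+\cdots+f_n+\cdots+f_\infty$$ (indices $n\in\mathbb{N}\cup\{\infty\}$, all terms morphisms $X\to Y$) satisfying the following: (i) $f_0$ is either zero or an isomorphism; (ii) for each finite $n>0$, the morphism $f_n$ is either zero or a linear combination of morphisms of the form $F(\overline{\alpha_n})\cdots F(\overline{\alpha_1})$, where $X=X_0\xrightarrow{\alpha_1}X_1\xrightarrow{\alpha_2}\cdots\xrightarrow{\alpha_n}X_n=Y$ is a path in $\Gamma$; and (iii) $f_\infty\in\operatorname{rad}^\infty(X,Y)$. Moreover, such a decomposition is unique, that is, if $f=g_0+g_1+\cdots+g_\infty$ is a decomposition with the same properties as the first, then $f_n=g_n$ for all $0\le n\le\infty$.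
   Context: Algebras are associative and unital; $\operatorname{mod} A$ is the category of finitely generated right $A$-modules. The radical $\operatorname{rad}_A$ is the ideal of $\operatorname{mod} A$ such that for $X,Y$ indecomposable $\operatorname{rad}_A(X,Y)$ is the set of non-isomorphisms $X\to Y$, extended to direct sums componentwise; its elements are called radical morphisms. Put $\operatorname{rad}^0=\operatorname{Hom}_A$, $\operatorname{rad}^1=\operatorname{rad}_A$, $\operatorname{rad}^n=\operatorname{rad}^{n-1}\cdot\operatorname{rad}$, $\operatorname{rad}^\infty=\bigcap_{n\ge 0}\operatorname{rad}^n$. A morphism $f:X\to Y$ is left minimal if every endomorphism $h$ of $Y$ with $hf=f$ is invertible; it is left almost split if it is radical, $X$ is indecomposable, and every radical morphism $u:X\to U$ factors as $u=u'f$ for some $u':Y\to U$. Right minimal and right almost split morphisms are defined dually. The Auslander-Reiten quiver of $A$ has as vertices the isomorphism classes of indecomposable $A$-modules, and $\dim_k \operatorname{rad}(M,N)/\operatorname{rad}^2(M,N)$ arrows from $M$ to $N$. A connected component $\Gamma$ is a translation quiver with the Auslander-Reiten translation $\tau$: for every non-projective vertex $x$ and every vertex $y$ a bijection $\alpha\mapsto\sigma(\alpha)$ from arrows $y\to x$ to arrows $\tau x\to y$ is fixed. Vertices of $\Gamma$ are identified with (fixed representatives of) indecomposable modules; $\operatorname{ind}\Gamma$ is the full subcategory of $\operatorname{mod} A$ given by the indecomposable modules in $\Gamma$. The path category $k\Gamma$ has the vertices of $\Gamma$ as objects, and as morphisms $x\to y$ the formal $k$-linear combinations of paths from $x$ to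 $y$. The mesh category $k(\Gamma)$ is the quotient of $k\Gamma$ by the ideal generated by the mesh relations $\sum \alpha\,\sigma(\alpha):\tau x\to x$, where $x$ is non-projective and the sum runs over all arrows $\alpha$ ending at $x$; $\overline{\alpha}$ is the class of an arrow $\alpha$. A Riedtmann functor is a $k$-linear functor $F:k(\Gamma)\to\operatorname{ind}\Gamma$ such that for every vertex $X$: (1) $FX=X$; (2) if $\alpha_i:X\to X_i$, $1\le i\le r$, are all the arrows starting at $X$, then $[F(\overline{\alpha_1})\ \cdots\ F(\overline{\alpha_r})]^t:X\to X_1\oplus\cdots\oplus X_r$ is left minimal and left almost split; (3) if $\alpha_i:X_i\to X$, $1\le i\le r$, are all the arrows ending at $X$, then $[F(\overline{\alpha_1})\ \cdots\ F(\overline{\alpha_r})]:X_1\oplus\cdots\oplus X_r\to X$ is right minimal and right almost split. $\Gamma$ is mesh-comparable via $F$ if $F:k(\Gamma)\to\operatorname{ind}\Gamma$ is a Riedtmann functor.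
   Formalization: Uniqueness as printed fails (A = k[x]/(x²), f = id_A: f_0 = 1, or f_0 = 1+x with f_2 = −x), so f_0 is also required to be a combination of images of paths of length 0: a scalar multiple of the identity if X = Y, zero otherwise; existence is proved with this, uniqueness among such decompositions. *)

(* Defs.v *)
From HB Require Import structures.
From Stdlib Require Import Relation_Operators.
From mathcomp Require Import all_boot all_algebra.
From mathcomp Require Import generic_quotient ring_quotient falgebra.
From mathcomp Require Import finmap monalg boolp.

Set Implicit Arguments.
Unset Strict Implicit.
Unset Printing Implicit Defensive.

Import GRing.Theory.
Import Quotient VectorInternalTheory.
Local Open Scope ring_scope.

(* Dependent finite products of vector spaces: the library only provides the
   vector space structure for non-dependent finite functions. *)
Section DependentProduct.
Variables (k : fieldType) (r : nat) (V : 'I_r -> vectType k).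

Definition dprod : Type := {dffun forall i, V i}.

HB.instance Definition _ := Choice.on dprod.

Definition mkdprod (v : forall i, V i) : dprod := finfun v.

Lemma dprodE v i : mkdprod v i = v i.
Proof. exact: ffunE. Qed.

Lemma dprodP (u v : dprod) : (forall i, u i = v i) <-> u = v.
Proof. exact: ffunP. Qed.

Let dzero := mkdprod (fun=> 0).
Let dopp (u : dprod) := mkdprod (fun i => - u i).
Let dadd (u v : dprod) := mkdprod (fun i => u i + v i).
Let dscale c (u : dprod) := mkdprod (fun i => c *: u i).

Fact daddA : associative dadd.
Proof. by move=> u v w; apply/dprodP => i; rewrite !dprodE addrA. Qed.
Fact daddC : commutative dadd.
Proof. by move=> u v; apply/dprodP => i; rewrite !dprodE addrC. Qed.
Fact dadd0 : left_id dzero dadd.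
Proof. by move=> u; apply/dprodP => i; rewrite !dprodE add0r. Qed.
Fact daddN : left_inverse dzero dopp dadd.
Proof. by move=> u; apply/dprodP => i; rewrite !dprodE addNr. Qed.

HB.instance Definition _ := GRing.isZmodule.Build dprod daddA daddC dadd0 daddN.

Fact dscaleA a b u : dscale a (dscale b u) = dscale (a * b) u.
Proof. by apply/dprodP => i; rewrite !dprodE scalerA. Qed.
Fact dscale1 : left_id 1 dscale.
Proof. by move=> u; apply/dprodP => i; rewrite !dprodE scale1r. Qed.
Fact dscaleDr : right_distributive dscale +%R.
Proof. by move=> a u v; apply/dprodP => i; rewrite !dprodE scalerDr. Qed.
Fact dscaleDl u : {morph dscale^~ u : a b / a + b}.
Proof. by move=> a b; apply/dprodP => i; rewrite !dprodE scalerDl. Qed.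

HB.instance Definition _ :=
  GRing.Zmodule_isLmodule.Build k dprod dscaleA dscale1 dscaleDr dscaleDl.

Lemma dprodDE (u v : dprod) i : (u + v) i = u i + v i.
Proof. exact: dprodE. Qed.
Lemma dprodZE c (u : dprod) i : (c *: u) i = c *: u i.
Proof. exact: dprodE. Qed.

Fact dprod_vect_iso : Vector.axiom (\sum_i dim (V i)) dprod.
Proof.
exists (fun u : dprod => \mxrow_i v2r (u i)).
  move=> c u v; apply/mxrowP => i; rewrite submxrowD mxrowK.
  rewrite dprodDE dprodZE linearP /= mxrowK; congr (_ + _).
  by rewrite -[in LHS](mxrowK (fun j => v2r (u j)) i); apply/rowP => j; rewrite !mxE.
exists (fun w => mkdprod (fun i => r2v (submxrow w i))) => [u|w].
  by apply/dprodP => i; rewrite dprodE mxrowK v2rK.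
by apply/mxrowP => i; rewrite mxrowK dprodE r2vK.
Qed.

HB.instance Definition _ := Lmodule_hasFinDim.Build k dprod dprod_vect_iso.

End DependentProduct.

(* a_0, ..., a_(r-1) are all the arrows starting (resp. ending) at x, without
   repetition. *)
Definition all_arrows_from (V : Type) (arr : V -> V -> finType) x r
    (y : 'I_r -> V) (a : forall i, arr x (y i)) : Prop :=
  bijective (fun i => existT (fun z => arr x z) (y i) (a i)).

Definition all_arrows_to (V : Type) (arr : V -> V -> finType) x r
    (y : 'I_r -> V) (a : forall i, arr (y i) x) : Prop :=
  bijective (fun i => existT (fun z => arr z x) (y i) (a i)).

Section Modules.
Variables (k : fieldType) (A : falgType k).

(* Finitely generated right A-modules.  As A is finite-dimensional over k,
   these are the right A-modules of finite dimension over k. *)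
Record rmodule := RModule {
  carrier :> vectType k;
  ract : carrier -> A -> carrier;
  ract_linearl : forall a, linear (ract^~ a);
  ract_linearr : forall v, linear (ract v);
  ract1 : forall v, ract v 1 = v;
  ractM : forall v a b, ract v (a * b) = ract (ract v a) b }.

Fact mulr_linearl (a : A) : linear (fun v : A => v * a).
Proof. by move=> c u v; rewrite mulrDl scalerAl. Qed.
Fact mulr_linearr (v : A) : linear (fun a : A => v * a).
Proof. by move=> c a b; rewrite mulrDr scalerAr. Qed.

Definition regular_module : rmodule :=
  @RModule A (fun v a => v * a) mulr_linearl mulr_linearr (@mulr1 A) (@mulrA A).

Section DirectSum.
Variables (r : nat) (M : 'I_r -> rmodule).

Let V i : vectType k := M i.
Let DE := (@dprodDE k r V, @dprodZE k r V, @dprodE k r V).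

Let dsact (v : dprod M) (a : A) : dprod M := mkdprod (fun i => ract (v i) a).

Fact dsact_linearl a : linear (dsact^~ a).
Proof.
move=> c u v; apply/dprodP => i.
by rewrite !DE ract_linearl.
Qed.
Fact dsact_linearr v : linear (dsact v).
Proof.
move=> c a b; apply/dprodP => i.
by rewrite !DE ract_linearr.
Qed.
Fact dsact1 v : dsact v 1 = v.
Proof. by apply/dprodP => i; rewrite dprodE ract1. Qed.
Fact dsactM v a b : dsact v (a * b) = dsact (dsact v a) b.
Proof. by apply/dprodP => i; rewrite !dprodE ractM. Qed.

Definition dsum : rmodule := RModule dsact_linearl dsact_linearr dsact1 dsactM.

(* [f_1 ... f_r]^t : X -> M_1 (+) ... (+) M_r *)
Definition dsum_col (X : rmodule) (f : forall i, 'Hom(X, M i)) : 'Hom(X, dsum) :=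
  linfun (fun x => mkdprod (fun i => f i x) : dsum).

(* [f_1 ... f_r] : M_1 (+) ... (+) M_r -> Y *)
Definition dsum_row (Y : rmodule) (f : forall i, 'Hom(M i, Y)) : 'Hom(dsum, Y) :=
  linfun (fun v : dsum => \sum_i f i ((v : dprod M) i)).

Lemma dsum_colE (X : rmodule) (f : forall i, 'Hom(X, M i)) (x : X) i :
  (dsum_col f x : dprod M) i = f i x.
Proof.
pose g (x : X) : dsum := mkdprod (fun i => f i x).
have lin_g : linear g.
  move=> c u v; apply/dprodP => j.
  by rewrite !DE linearP.
pose gL := GRing.isLinear.Build _ _ _ _ g lin_g.
pose h : {linear X -> dsum} := HB.pack g gL.
by rewrite (lfunE h) /= dprodE.
Qed.

Lemma dsum_rowE (Y : rmodule) (f : forall i, 'Hom(M i, Y)) (v : dsum) :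
  dsum_row f v = \sum_i f i ((v : dprod M) i).
Proof.
pose g (v : dsum) : Y := \sum_i f i ((v : dprod M) i).
have lin_g : linear g.
  move=> c u w; rewrite /g scaler_sumr -big_split /=; apply: eq_bigr => i _.
  by rewrite !DE linearP.
pose gL := GRing.isLinear.Build _ _ _ _ g lin_g.
pose h : {linear dsum -> Y} := HB.pack g gL.
by rewrite (lfunE h).
Qed.

End DirectSum.

Implicit Types X Y M N P U : rmodule.

Definition is_rhom X Y (f : 'Hom(X, Y)) : Prop :=
  forall x a, f (ract x a) = ract (f x) a.

Definition is_riso X Y (f : 'Hom(X, Y)) : Prop :=
  is_rhom f /\
  exists g : 'Hom(Y, X),
    [/\ is_rhom g, (g \o f)%VF = \1%VF & (f \o g)%VF = \1%VF].

Definition isomorphic X Y : Prop := exists f : 'Hom(X, Y), is_riso f.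

Definition is_submodule M (U : {vspace M}) : Prop :=
  forall u a, u \in U -> ract u a \in U.

Definition indecomposable M : Prop :=
  \dim {: M} <> 0%N /\
  forall U V : {vspace M}, is_submodule U -> is_submodule V ->
    (U + V = fullv)%VS -> (U :&: V = 0)%VS -> U = 0%VS \/ V = 0%VS.

(* phi decomposes X and psi decomposes Y as finite direct sums of
   indecomposables; psi j \o f \o phi i are the components of f. *)
Definition radical X Y (f : 'Hom(X, Y)) : Prop :=
  is_rhom f /\
  exists (r s : nat) (M : 'I_r -> rmodule) (N : 'I_s -> rmodule)
    (phi : forall i, 'Hom(M i, X)) (psi : forall j, 'Hom(Y, N j)),
    [/\ forall i, indecomposable (M i), forall j, indecomposable (N j),
        is_riso (dsum_row phi), is_riso (dsum_col psi)
      & forall i j, ~ is_riso (psi j \o f \o phi i)%VF].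

(* rad^(n+2) = rad^(n+1) . rad as a product of ideals: finite sums of
   composites through arbitrary modules. *)
Fixpoint rad_pow (n : nat) X Y (f : 'Hom(X, Y)) : Prop :=
  match n with
  | 0 => is_rhom f
  | 1 => radical f
  | m.+1 =>
      exists (r : nat) (Z : 'I_r -> rmodule)
        (g : forall i, 'Hom(X, Z i)) (h : forall i, 'Hom(Z i, Y)),
        [/\ forall i, radical (g i), forall i, rad_pow m (h i)
          & f = \sum_i (h i \o g i)%VF]
  end.

Definition rad_infty X Y (f : 'Hom(X, Y)) : Prop := forall n, rad_pow n f.

Definition left_minimal X Y (f : 'Hom(X, Y)) : Prop :=
  is_rhom f /\
  forall h : 'Hom(Y, Y), is_rhom h -> (h \o f)%VF = f -> is_riso h.

Definition right_minimal X Y (f : 'Hom(X, Y)) : Prop :=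
  is_rhom f /\
  forall h : 'Hom(X, X), is_rhom h -> (f \o h)%VF = f -> is_riso h.

Definition left_almost_split X Y (f : 'Hom(X, Y)) : Prop :=
  [/\ radical f, indecomposable X
    & forall U (u : 'Hom(X, U)), radical u ->
      exists u' : 'Hom(Y, U), is_rhom u' /\ u = (u' \o f)%VF].

Definition right_almost_split X Y (f : 'Hom(X, Y)) : Prop :=
  [/\ radical f, indecomposable Y
    & forall U (u : 'Hom(U, Y)), radical u ->
      exists u' : 'Hom(U, X), is_rhom u' /\ u = (f \o u')%VF].

Definition projective P : Prop :=
  forall M N (g : 'Hom(M, N)) (h : 'Hom(P, N)),
    is_rhom g -> limg g = fullv -> is_rhom h ->
    exists h' : 'Hom(P, M), is_rhom h' /\ h = (g \o h')%VF.

(* P1 -> P0 -> M -> 0 exact with P0 -> M and P1 -> Ker p0 projective covers *)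
Definition minimal_projective_presentation P1 P0 M
    (p1 : 'Hom(P1, P0)) (p0 : 'Hom(P0, M)) : Prop :=
  [/\ projective P1 /\ projective P0, limg p0 = fullv, limg p1 = lker p0,
      right_minimal p0 & right_minimal p1].

(* The left A-module structure of Hom_A(P, A). *)
Definition lact_dual P (a : A) (g : 'Hom(P, regular_module)) :
    'Hom(P, regular_module) :=
  linfun (fun x => (a * g x : A) : regular_module).

(* N is isomorphic to D Tr M, where Tr M is the cokernel of
   Hom_A(p1, A) : Hom_A(P0, A) -> Hom_A(P1, A) and D = Hom_k(-, k):
   ev identifies N with the k-linear forms on Hom_A(P1, A) that vanish on the
   image of Hom_A(p1, A). *)
Definition is_DTr M N : Prop :=
  exists (P1 P0 : rmodule) (p1 : 'Hom(P1, P0)) (p0 : 'Hom(P0, M)),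
    minimal_projective_presentation p1 p0 /\
  exists ev : N -> 'Hom(P1, regular_module) -> k,
    [/\ forall c n n' g, is_rhom g -> ev (c *: n + n') g = c * ev n g + ev n' g,
        forall n a g, is_rhom g -> ev (ract n a) g = ev n (lact_dual a g),
        forall n c g g', is_rhom g -> is_rhom g' ->
          ev n (c *: g + g') = c * ev n g + ev n g',
        forall n (h : 'Hom(P0, regular_module)), is_rhom h ->
          ev n (h \o p1)%VF = 0
      & forall phi : 'Hom(P1, regular_module) -> k,
          (forall c g g', is_rhom g -> is_rhom g' ->
             phi (c *: g + g') = c * phi g + phi g') ->
          (forall h : 'Hom(P0, regular_module), is_rhom h ->
             phi (h \o p1)%VF = 0) ->
          exists! n, forall g, is_rhom g -> phi g = ev n g].

(* dim_k rad(M, N) / rad^2(M, N) = d: some d elements of rad(M, N) form a basis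
   modulo rad^2(M, N). *)
Definition irr_dim M N (d : nat) : Prop :=
  exists e : 'I_d -> 'Hom(M, N),
    (forall i, radical (e i)) /\
    forall f, radical f ->
      exists! c : {ffun 'I_d -> k}, rad_pow 2 (f - \sum_i c i *: e i).

Definition has_arrow M N : Prop :=
  exists f : 'Hom(M, N), radical f /\ ~ rad_pow 2 f.

(* A connected component of the Auslander-Reiten quiver of A, with chosen
   representatives of its vertices.  Translation quivers are locally finite by
   definition: finitely many arrows start or end at each vertex. *)
Record AR_component := ARComponent {
  vertex : Type;
  vmod : vertex -> rmodule;
  arrow : vertex -> vertex -> finType;
  vmod_indec : forall x, indecomposable (vmod x);
  vmod_inj : forall x y, isomorphic (vmod x) (vmod y) -> x = y;
  arrow_dim : forall x y, irr_dim (vmod x) (vmod y) #|arrow x y|;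
  vertex_nonempty : inhabited vertex;
  component_connected : forall x y,
    clos_refl_sym_trans vertex (fun x' y' => (0 < #|arrow x' y'|)%N) x y;
  component_closed : forall x N, indecomposable N ->
    has_arrow (vmod x) N \/ has_arrow N (vmod x) ->
    exists y, isomorphic (vmod y) N;
  locally_finite_out : forall x,
    exists (r : nat) (y : 'I_r -> vertex) (a : forall i, arrow x (y i)),
      all_arrows_from a;
  locally_finite_in : forall x,
    exists (r : nat) (y : 'I_r -> vertex) (a : forall i, arrow (y i) x),
      all_arrows_to a;
  tau : forall x, ~ projective (vmod x) -> vertex;
  tau_DTr : forall x (px : ~ projective (vmod x)),
    is_DTr (vmod x) (vmod (tau px));
  sigma : forall x (px : ~ projective (vmod x)) y,
    arrow y x -> arrow (tau px) y;
  sigma_bij : forall x (px : ~ projective (vmod x)) y,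
    bijective (@sigma x px y) }.

End Modules.

Section MeshCategory.
Variables (k : fieldType) (A : falgType k) (G : AR_component A).
Implicit Types x y z : vertex G.

Inductive qpath x : vertex G -> Type :=
| qnil : qpath x x
| qsnoc y z : qpath x y -> arrow y z -> qpath x z.

HB.instance Definition _ x y := gen_eqMixin (qpath x y).
HB.instance Definition _ x y := gen_choiceMixin (qpath x y).

Fixpoint qlength x y (p : qpath x y) : nat :=
  if p is qsnoc _ _ p' _ then (qlength p').+1 else 0%N.

Fixpoint qcat x y z (p : qpath x y) (q : qpath y z) : qpath x z :=
  match q with
  | qnil => p
  | qsnoc _ _ q' a => qsnoc (qcat p q') a
  end.

(* Morphisms of the path category: the free k-module on the paths. *)
Definition path_hom x y := {malg k[qpath x y]}.

Definition of_path x y (p : qpath x y) : path_hom x y :=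
  << p >>.

Definition path_comp x y z (v : path_hom y z) (u : path_hom x y) :
    path_hom x z :=
  \sum_(p <- msupp u) \sum_(q <- msupp v)
    << u@_p * v@_q *g qcat p q >>.

Definition arrow_path x y (a : arrow x y) : qpath x y := qsnoc (qnil x) a.

(* The ideal of the path category generated by the mesh relations. *)
Inductive mesh_ideal : forall x y, path_hom x y -> Prop :=
| mesh_rel x (px : ~ projective (vmod x)) r (y : 'I_r -> vertex G)
    (a : forall i, arrow (y i) x) : all_arrows_to a ->
    mesh_ideal (\sum_i path_comp (of_path (arrow_path (a i)))
                                 (of_path (arrow_path (sigma px (a i)))))
| mesh_ideal0 x y : mesh_ideal (0 : path_hom x y)
| mesh_idealP x y c (u v : path_hom x y) :
    mesh_ideal u -> mesh_ideal v -> mesh_ideal (c *: u + v)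
| mesh_ideal_compl x y z (v : path_hom y z) (u : path_hom x y) :
    mesh_ideal u -> mesh_ideal (path_comp v u)
| mesh_ideal_compr x y z (v : path_hom y z) (u : path_hom x y) :
    mesh_ideal v -> mesh_ideal (path_comp v u).

Definition mesh_pred x y : {pred path_hom x y} :=
  fun u => `[< mesh_ideal u >].

Fact mesh_zmod_closed x y : zmod_closed (mesh_pred (x := x) (y := y)).
Proof.
split=> [|u v /asboolP Iu /asboolP Iv]; apply/asboolP.
  exact: mesh_ideal0.
by rewrite addrC -scaleN1r; apply: mesh_idealP.
Qed.

HB.instance Definition _ x y :=
  GRing.isZmodClosed.Build (path_hom x y) (@mesh_pred x y)
    (@mesh_zmod_closed x y).

(* Morphisms of the mesh category k(G). *)
Definition mesh_hom x y : Type := {quot (@mesh_pred x y)}.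
HB.instance Definition _ x y := GRing.Zmodule.on (mesh_hom x y).

Definition mesh_class x y (u : path_hom x y) : mesh_hom x y :=
  (\pi_({quot (@mesh_pred x y)}) u)%qT.

Lemma mesh_classP x y (u v : path_hom x y) :
  mesh_class u = mesh_class v <-> mesh_ideal (u - v).
Proof.
by split=> [/eqP|/asboolP uv]; first (by rewrite -idealrBE => /asboolP);
  apply/eqP; rewrite -idealrBE.
Qed.

Lemma mesh_repr x y (w : mesh_hom x y) : {u : path_hom x y | w = mesh_class u}.
Proof. by exists (repr (w : {quot (@mesh_pred x y)})); rewrite /mesh_class reprK. Qed.

Lemma mesh_classD x y (u v : path_hom x y) :
  mesh_class (u + v) = mesh_class u + mesh_class v.
Proof. exact: raddfD. Qed.

Lemma mesh_ideal_scale x y c (u : path_hom x y) :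
  mesh_ideal u -> mesh_ideal (c *: u).
Proof.
by move=> Iu; rewrite -[c *: u]addr0; apply: mesh_idealP => //; apply: mesh_ideal0.
Qed.

Definition mesh_scale x y (c : k) (w : mesh_hom x y) : mesh_hom x y :=
  mesh_class (c *: sval (mesh_repr w)).

Lemma mesh_scaleE x y c (u : path_hom x y) :
  mesh_scale c (mesh_class u) = mesh_class (c *: u).
Proof.
rewrite /mesh_scale; case: mesh_repr => v /= uv; apply/mesh_classP.
by rewrite -scalerBr; apply/mesh_ideal_scale/mesh_classP.
Qed.

Fact mesh_scaleA x y a b (w : mesh_hom x y) :
  mesh_scale a (mesh_scale b w) = mesh_scale (a * b) w.
Proof. by have [u ->] := mesh_repr w; rewrite !mesh_scaleE scalerA. Qed.
Fact mesh_scale1 x y : left_id 1 (@mesh_scale x y).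
Proof. by move=> w; have [u ->] := mesh_repr w; rewrite mesh_scaleE scale1r. Qed.
Fact mesh_scaleDr x y : right_distributive (@mesh_scale x y) +%R.
Proof.
move=> a w w'; have [u ->] := mesh_repr w; have [u' ->] := mesh_repr w'.
by rewrite -mesh_classD !mesh_scaleE scalerDr mesh_classD.
Qed.
Fact mesh_scaleDl x y (w : mesh_hom x y) :
  {morph (@mesh_scale x y)^~ w : a b / a + b}.
Proof.
move=> a b; have [u ->] := mesh_repr w.
by rewrite !mesh_scaleE scalerDl mesh_classD.
Qed.

HB.instance Definition _ x y := GRing.Zmodule_isLmodule.Build k (mesh_hom x y)
  (@mesh_scaleA x y) (@mesh_scale1 x y) (@mesh_scaleDr x y) (@mesh_scaleDl x y).

Lemma mesh_classZ x y c (u : path_hom x y) :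
  mesh_class (c *: u) = c *: mesh_class u.
Proof. by rewrite -mesh_scaleE. Qed.

Section PathComp.
Variables x y z : vertex G.
Local Open Scope fset_scope.

Let cterm (v : path_hom y z) (u : path_hom x y) p q : path_hom x z :=
  << u@_p * v@_q *g qcat p q >>.

Lemma path_compEw (d : {fset qpath x y}) (e : {fset qpath y z})
    (v : path_hom y z) (u : path_hom x y) :
  msupp u `<=` d -> msupp v `<=` e ->
  path_comp v u = \sum_(p <- d) \sum_(q <- e) cterm v u p q.
Proof.
move=> le_d le_e; rewrite /path_comp (big_fset_incl _ le_d) /=; last first.
  by move=> p _ /mcoeff_outdom up; rewrite big1 // => q _; rewrite up mul0r monalgU0.
apply: eq_bigr => p _; apply: big_fset_incl => // q _ /mcoeff_outdom vq.
by rewrite vq mulr0 monalgU0.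
Qed.

Lemma path_comp_linearl (u : path_hom x y) :
  linear (fun v : path_hom y z => path_comp v u).
Proof.
move=> c v w.
have le_v : msupp v `<=` msupp v `|` msupp w by apply: fsubsetUl.
have le_w : msupp w `<=` msupp v `|` msupp w by apply: fsubsetUr.
have le_s : msupp (c *: v + w) `<=` msupp v `|` msupp w.
  by apply: fsubset_trans (msuppD_le _ _) _; apply: fsetSU; apply: msuppZ_le.
have le_u : msupp u `<=` msupp u by apply: fsubset_refl.
rewrite (path_compEw le_u le_s) (path_compEw le_u le_v) (path_compEw le_u le_w).
rewrite scaler_sumr -big_split; apply: eq_bigr => p _ /=.
rewrite scaler_sumr -big_split; apply: eq_bigr => q _ /=.
by apply/malgP => s; rewrite !mcoeffsE mulrDr mulrCA mulrnDl mulrnAr.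
Qed.

Lemma path_comp_linearr (v : path_hom y z) :
  linear (fun u : path_hom x y => path_comp v u).
Proof.
move=> c u w.
have le_u : msupp u `<=` msupp u `|` msupp w by apply: fsubsetUl.
have le_w : msupp w `<=` msupp u `|` msupp w by apply: fsubsetUr.
have le_s : msupp (c *: u + w) `<=` msupp u `|` msupp w.
  by apply: fsubset_trans (msuppD_le _ _) _; apply: fsetSU; apply: msuppZ_le.
have le_v : msupp v `<=` msupp v by apply: fsubset_refl.
rewrite (path_compEw le_s le_v) (path_compEw le_u le_v) (path_compEw le_w le_v).
rewrite scaler_sumr -big_split; apply: eq_bigr => p _ /=.
rewrite scaler_sumr -big_split; apply: eq_bigr => q _ /=.
by apply/malgP => s; rewrite !mcoeffsE mulrDl -mulrA mulrnDl mulrnAr.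
Qed.

End PathComp.

Definition mesh_id x : mesh_hom x x := mesh_class (of_path (qnil x)).

Definition mesh_comp x y z (w' : mesh_hom y z) (w : mesh_hom x y) :
    mesh_hom x z :=
  mesh_class (path_comp (sval (mesh_repr w')) (sval (mesh_repr w))).

Lemma mesh_compE x y z (v : path_hom y z) (u : path_hom x y) :
  mesh_comp (mesh_class v) (mesh_class u) = mesh_class (path_comp v u).
Proof.
rewrite /mesh_comp; case: (mesh_repr (mesh_class v)) => v' /= /esym/mesh_classP Iv.
case: (mesh_repr (mesh_class u)) => u' /= /esym/mesh_classP Iu.
apply/mesh_classP.
have -> : path_comp v' u' - path_comp v u =
    path_comp (v' - v) u' + path_comp v (u' - u).
  have -> : v' - v = (-1) *: v + v' by rewrite scaleN1r addrC.
  have -> : u' - u = (-1) *: u + u' by rewrite scaleN1r addrC.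
  rewrite path_comp_linearl path_comp_linearr !scaleN1r.
  by rewrite [- _ + path_comp v' u']addrC [- _ + path_comp v u']addrC addrA subrK.
rewrite -[X in X + _]scale1r; apply: mesh_idealP.
  exact: mesh_ideal_compr.
exact: mesh_ideal_compl.
Qed.

(* The class in the mesh category of an arrow. *)
Definition arrow_class x y (a : arrow x y) : mesh_hom x y :=
  mesh_class (of_path (arrow_path a)).

(* k-linear functors k(G) -> ind G that are the identity on objects, ind G
   being the full subcategory of mod A on the modules vmod x.  The requirement
   F X = X on Riedtmann functors is thus part of the typing. *)
Record mesh_functor := MeshFunctor {
  fmor : forall x y, mesh_hom x y -> 'Hom(vmod x, vmod y);
  fmor_rhom : forall x y (w : mesh_hom x y), is_rhom (fmor w);
  fmor_linear : forall x y, linear (@fmor x y);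
  fmor_id : forall x, fmor (mesh_id x) = \1%VF;
  fmor_comp : forall x y z (w' : mesh_hom y z) (w : mesh_hom x y),
    fmor (mesh_comp w' w) = (fmor w' \o fmor w)%VF }.

Definition Riedtmann (F : mesh_functor) : Prop :=
  (forall x r (y : 'I_r -> vertex G) (a : forall i, arrow x (y i)),
     all_arrows_from a ->
     let f := dsum_col (fun i => fmor F (arrow_class (a i))) in
     left_minimal f /\ left_almost_split f) /\
  (forall x r (y : 'I_r -> vertex G) (a : forall i, arrow (y i) x),
     all_arrows_to a ->
     let f := dsum_row (fun i => fmor F (arrow_class (a i))) in
     right_minimal f /\ right_almost_split f).

Definition mesh_comparable (F : mesh_functor) : Prop := Riedtmann F.

(* F(a_n) \o ... \o F(a_1) for a path X = x_0 -a_1-> ... -a_n-> x_n = Y *)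
Fixpoint fpath (F : mesh_functor) x y (p : qpath x y) : 'Hom(vmod x, vmod y) :=
  match p with
  | qnil => \1%VF
  | qsnoc _ _ p' a => (fmor F (arrow_class a) \o fpath F p')%VF
  end.

Definition path_combination (F : mesh_functor) (n : nat) x y
    (f : 'Hom(vmod x, vmod y)) : Prop :=
  exists (m : nat) (c : 'I_m -> k) (p : 'I_m -> qpath x y),
    (forall i, qlength (p i) = n) /\ f = \sum_i c i *: fpath F (p i).

(* f = f_0 + f_1 + ... + f_infty, where f_n = fn n and f_infty = finf *)
Definition is_decomposition (F : mesh_functor) x y (f : 'Hom(vmod x, vmod y))
    (fn : nat -> 'Hom(vmod x, vmod y)) (finf : 'Hom(vmod x, vmod y)) : Prop :=
  [/\ exists N, (forall n, (N <= n)%N -> fn n = 0) /\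
                f = \sum_(n < N) fn n + finf,
      fn 0%N = 0 \/ is_riso (fn 0%N),
      forall n, (0 < n)%N -> fn n = 0 \/ path_combination F n (fn n)
    & rad_infty finf].

End MeshCategory.

(* Main.v *)
Require Import Defs.
From mathcomp Require Import all_boot all_algebra falgebra.
From mathcomp Require Import monalg boolp.

(** Why the theorem holds.

    Existence.  A morphism f : X -> Y between vertices is a scalar plus a radical
    map, because k is algebraically closed.  The radical part factors through the
    right almost split map with components F(a_i), for the arrows a_i ending
    at Y, and the factors X -> X_i can be treated in the same way.  After n rounds f
    is a sum of combinations of paths of lengths below n and an element of
    rad^n(X, Y) ([finite_expansion]).  As Hom(X, Y) is finite-dimensional,
    rad^n(X, Y) is the infinite radical for n large ([rad_pow_stable]).

    Uniqueness.  It suffices that a combination of paths of length n lying in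
    rad^(n+1) is zero ([graded_faithfulness]): then in a difference of two
    expansions the homogeneous parts vanish from the lowest degree upwards.
    This is proved by induction on n.  A combination f of length n + 1 is
    sum F(a_i) w_i, and if it lies in rad^(n+2) it is also sum F(a_i) u_i with
    u_i in rad^(n+1).  The family w - u lies in the kernel of the right almost
    split map onto Y.  By the mesh relations this kernel is the image of the left
    almost split map starting at tau Y ([mesh_kernel]), so
    w_i - u_i = F(sigma a_i) v, and comparing degrees replaces v by its part of
    degree n - 1 while removing u; the mesh relation then gives f = 0.

    The exactness of meshes is obtained without the Auslander-Reiten formula:
    [almost_split_exact] shows that a left minimal left almost split map f and a
    right minimal right almost split map g with g f = 0 form an exact pair
    as soon as g is not injective.

    Radical maps are defined through decompositions into indecomposables.  To know
    that they form an ideal one needs that such decompositions exist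
    ([decomposition]) and that endomorphism rings of indecomposables are local
    ([local_sum]); [radicalP] then gives a description in which the ideal
    properties are evident. *)

Set Implicit Arguments.
Unset Strict Implicit.
Unset Printing Implicit Defensive.

Import GRing.Theory.
Local Open Scope ring_scope.

(** * Module homomorphisms, submodules and quotients *)

Section ModuleHoms.
Variables (k : fieldType) (A : falgType k).
Implicit Types (X Y Z M N : rmodule A).

Lemma ractB M (u v : M) a : ract (u - v) a = ract u a - ract v a.
Proof.
by rewrite addrC -scaleN1r ract_linearl scaleN1r addrC.
Qed.

Lemma ractD M (u v : M) a : ract (u + v) a = ract u a + ract v a.
Proof. by rewrite -[u]scale1r ract_linearl !scale1r. Qed.

Lemma ract_sum M I (s : seq I) (P : pred I) (f : I -> M) a :
  ract (\sum_(i <- s | P i) f i) a = \sum_(i <- s | P i) ract (f i) a.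
Proof.
elim/big_rec2: _ => [|i u v _ <-]; last by rewrite ractD.
by rewrite -[in LHS](subrr 0) ractB subrr.
Qed.

Lemma rhom1 X : is_rhom (\1%VF : 'Hom(X, X)).
Proof. by move=> x a; rewrite !id_lfunE. Qed.

Lemma rhom0 X Y : is_rhom (0 : 'Hom(X, Y)).
Proof.
move=> x a; rewrite !zero_lfunE.
by rewrite -[in RHS](subrr 0) ractB subrr.
Qed.

Lemma rhomP X Y c (f g : 'Hom(X, Y)) :
  is_rhom f -> is_rhom g -> is_rhom (c *: f + g).
Proof.
move=> hf hg x a.
by rewrite !add_lfunE !scale_lfunE hf hg ract_linearl.
Qed.

Lemma rhomD X Y (f g : 'Hom(X, Y)) : is_rhom f -> is_rhom g -> is_rhom (f + g).
Proof. by move=> hf hg; rewrite -[f]scale1r; apply: rhomP. Qed.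

Lemma rhomZ X Y c (f : 'Hom(X, Y)) : is_rhom f -> is_rhom (c *: f).
Proof. by move=> hf; rewrite -[_ *: _]addr0; apply: rhomP => //; apply: rhom0. Qed.

Lemma rhomB X Y (f g : 'Hom(X, Y)) : is_rhom f -> is_rhom g -> is_rhom (f - g).
Proof. by move=> hf hg; rewrite addrC -scaleN1r; apply: rhomP. Qed.

Lemma rhom_comp X Y Z (g : 'Hom(Y, Z)) (f : 'Hom(X, Y)) :
  is_rhom g -> is_rhom f -> is_rhom (g \o f)%VF.
Proof. by move=> hg hf x a; rewrite !comp_lfunE hf hg. Qed.

Lemma rhom_sum X Y I (s : seq I) (P : pred I) (f : I -> 'Hom(X, Y)) :
  (forall i, P i -> is_rhom (f i)) -> is_rhom (\sum_(i <- s | P i) f i).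
Proof.
by move=> hf; elim/big_rec: _ => [|i g Pi]; [exact: rhom0 | apply/rhomD/hf].
Qed.

Lemma comp_lfun_suml X Y Z I (s : seq I) (P : pred I) (f : I -> 'Hom(Y, Z))
    (g : 'Hom(X, Y)) :
  ((\sum_(i <- s | P i) f i) \o g = \sum_(i <- s | P i) (f i \o g))%VF.
Proof.
by elim/big_rec2: _ => [|i u v _ <-]; rewrite ?comp_lfun0l ?comp_lfunDl.
Qed.

Lemma comp_lfun_sumr X Y Z I (s : seq I) (P : pred I) (f : 'Hom(Y, Z))
    (g : I -> 'Hom(X, Y)) :
  (f \o (\sum_(i <- s | P i) g i) = \sum_(i <- s | P i) (f \o g i))%VF.
Proof.
by elim/big_rec2: _ => [|i u v _ <-]; rewrite ?comp_lfun0r ?comp_lfunDr.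
Qed.

(** The map t is e composed with a linear section of q, after z; it is A-linear
    because e does not see the choice of preimages under q.  With e = 1 this
    lifts z through an injective q, with z = 1 it descends e along a surjective
    q; the mixed case is what makes [almost_split_exact] work. *)
Lemma factor_through X Y Z M (q : 'Hom(X, Y)) (e : 'Hom(X, M)) (z : 'Hom(Z, Y)) :
    is_rhom q -> is_rhom e -> is_rhom z ->
    (forall y, q y = 0 -> e y = 0) -> (forall x, exists y, q y = z x) ->
  exists t : 'Hom(Z, M),
    is_rhom t /\ forall y x, q y = z x -> t x = e y.
Proof.
move=> hq he hz qe zq; exists (e \o (q^-1 \o z))%VF.
have tE y x : q y = z x -> (e \o (q^-1 \o z))%VF x = e y.
  move=> yx; apply/eqP; rewrite -subr_eq0 !comp_lfunE -linearB /= -yx; apply/eqP.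
  by apply: qe; rewrite linearB /= -!comp_lfunE comp_lfunA inv_lfun_def subrr.
split=> // x a; have [y yx] := zq x.
by rewrite (tE _ _ yx) -he; apply: tE; rewrite hq hz yx.
Qed.

Lemma riso_bij X Y (f : 'Hom(X, Y)) :
  is_rhom f -> lker f = 0%VS -> limg f = fullv -> is_riso f.
Proof.
move=> hf /eqP/lker0P injf imf; split=> //.
have sf y : exists x, f x = \1%VF y.
  rewrite id_lfunE; have : y \in limg f by rewrite imf memvf.
  by case/memv_imgP => x _ ->; exists x.
have [|//|g [hg gE]] := factor_through hf (@rhom1 X) (@rhom1 Y).
  by move=> x fx0; rewrite id_lfunE; apply: injf; rewrite fx0 linear0.
exists g; split=> //; apply/lfunP => x; rewrite comp_lfunE.
  by rewrite (gE x) ?id_lfunE.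
by have [y yx] := sf x; rewrite (gE y) // -yx id_lfunE.
Qed.

Lemma riso_rhom X Y (f : 'Hom(X, Y)) : is_riso f -> is_rhom f.
Proof. by case. Qed.

Lemma riso_ker X Y (f : 'Hom(X, Y)) x : is_riso f -> f x = 0 -> x = 0.
Proof.
case=> _ [g [_ gf _]] fx0.
by rewrite -[x]id_lfunE -gf comp_lfunE fx0 linear0.
Qed.

Lemma riso_inj X Y (f : 'Hom(X, Y)) :
  is_rhom f -> (dim Y <= dim X)%N -> (forall x, f x = 0 -> x = 0) -> is_riso f.
Proof.
move=> hf leYX kf; have kf0 : lker f = 0%VS.
  apply/eqP; rewrite -subv0; apply/subvP => x; rewrite memv_ker memv0.
  by move=> /eqP/kf ->.
apply: riso_bij => //; apply/eqP; rewrite eqEdim subvf /= limg_dim_eq.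
  by rewrite !dimvf.
by rewrite kf0 capv0.
Qed.

Lemma riso_endo X (f : 'Hom(X, X)) :
  is_rhom f -> (forall x, f x = 0 -> x = 0) -> is_riso f.
Proof. by move=> hf; apply: riso_inj. Qed.

Lemma riso_surj X Y (f : 'Hom(X, Y)) :
  is_rhom f -> (dim X <= dim Y)%N -> (forall y, exists x, f x = y) -> is_riso f.
Proof.
move=> hf leXY sf; have imf : limg f = fullv.
  apply/eqP; rewrite eqEsubv subvf; apply/subvP => y _.
  by have [x <-] := sf y; apply: memv_img; apply: memvf.
apply: riso_bij => //; apply/eqP; rewrite -dimv_eq0.
have := limg_ker_dim f fullv; rewrite capfv imf !dimvf => dE.
by rewrite -(eqn_add2r (dim Y)) dE add0n eqn_leq leXY -dE leq_addl.
Qed.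

Lemma riso_comp X Y Z (g : 'Hom(Y, Z)) (f : 'Hom(X, Y)) :
  is_riso g -> is_riso f -> is_riso (g \o f)%VF.
Proof.
move=> [hg [g' [hg' g'g gg']]] [hf [f' [hf' f'f ff']]].
split; first exact: rhom_comp.
exists (f' \o g')%VF; split; first exact: rhom_comp.
  by rewrite comp_lfunA -(comp_lfunA f') g'g comp_lfun1r.
by rewrite comp_lfunA -(comp_lfunA g) ff' comp_lfun1r.
Qed.

Lemma riso1 X : is_riso (\1%VF : 'Hom(X, X)).
Proof.
split; first exact: rhom1.
by exists \1%VF; split; rewrite ?comp_lfun1l //; exact: rhom1.
Qed.

Lemma riso_inv X Y (f : 'Hom(X, Y)) : is_riso f ->
  exists g : 'Hom(Y, X), [/\ is_riso g, (g \o f)%VF = \1%VF & (f \o g)%VF = \1%VF].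
Proof. by case=> hf [g [hg gf fg]]; exists g; split=> //; split=> //; exists f. Qed.

Lemma risoZ X Y c (f : 'Hom(X, Y)) : c != 0 -> is_riso f -> is_riso (c *: f).
Proof.
move=> c0 [hf [g [hg gf fg]]]; split; first exact: rhomZ.
exists (c^-1 *: g); split; first exact: rhomZ.
  by rewrite -comp_lfunZl -comp_lfunZr scalerA mulVf // scale1r.
by rewrite -comp_lfunZl -comp_lfunZr scalerA mulfV // scale1r.
Qed.

Lemma submodule_ker X Y (f : 'Hom(X, Y)) : is_rhom f -> is_submodule (lker f).
Proof.
move=> hf u a; rewrite !memv_ker hf => /eqP ->.
by have := @rhom0 X Y u a; rewrite !zero_lfunE => <-.
Qed.

Lemma submodule_img X Y (f : 'Hom(X, Y)) : is_rhom f -> is_submodule (limg f).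
Proof.
move=> hf u a /memv_imgP[x _ ->]; rewrite -hf.
by apply: memv_img; apply: memvf.
Qed.

(** Transporting the action to [subvs_of U] turns a stable subspace into a module. *)
Lemma submodule_inclusion M (U : {vspace M}) : is_submodule U ->
  exists (N : rmodule A) (i : 'Hom(N, M)),
    [/\ is_rhom i, forall x, i x = 0 -> x = 0 & limg i = U].
Proof.
move=> hU; pose V : vectType k := subvs_of U.
pose act (v : V) (a : A) : V := vsproj U (ract (vsval v) a).
have actE v a : vsval (act v a) = ract (vsval v) a.
  by rewrite vsprojK //; apply/hU/subvsP.
have l1 a : linear (act^~ a).
  by move=> c u v; apply: val_inj; rewrite /= !actE linearP /= ract_linearl.
have l2 v : linear (act v).
  by move=> c a b; apply: val_inj; rewrite /= !actE ract_linearr.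
have a1 v : act v 1 = v by apply: val_inj; rewrite /= actE ract1.
have aM v a b : act v (a * b) = act (act v a) b.
  by apply: val_inj; rewrite /= !actE ractM.
pose N := @RModule k A V act l1 l2 a1 aM.
exists N, (linfun (vsval : V -> M) : 'Hom(N, M)).
have iE (x : N) : (linfun (vsval : V -> M) : 'Hom(N, M)) x = vsval (x : V) by rewrite lfunE.
split=> [x a|x|].
- by rewrite !iE /= actE.
- by rewrite iE => x0; apply: val_inj; rewrite /= x0.
apply/vspaceP => x; apply/memv_imgP/idP => [[y _ ->]|xU].
  by rewrite iE subvsP.
by exists (vsproj U x); rewrite ?memvf ?iE ?vsprojK.
Qed.

(** The carrier of the quotient is the image of the linear projection 1 - projv U,
    whose kernel is U; the action is computed on representatives. *)
Lemma quotient_projection M (U : {vspace M}) : is_submodule U ->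
  exists (N : rmodule A) (p : 'Hom(M, N)),
    [/\ is_rhom p, forall y, exists x, p x = y & lker p = U].
Proof.
move=> hU; pose q : 'End(M) := (\1 - projv U)%VF.
have qE x : q x = x - projv U x by rewrite add_lfunE opp_lfunE id_lfunE.
have kq x : (q x == 0) = (x \in U).
  rewrite qE subr_eq0; apply/eqP/idP => [->|/projv_id-> //]; exact: memv_proj.
pose V : vectType k := subvs_of (limg q).
have qV x : vsval (vsproj (limg q) (q x)) = q x.
  by rewrite vsprojK // memv_img ?memvf.
pose p : 'Hom(M, V) := (linfun (vsproj (limg q)) \o q)%VF.
have pE x : vsval (p x) = q x by rewrite comp_lfunE lfunE /= qV.
have sp y : exists x, p x = y.
  have /memv_imgP[x _ xy] := subvsP y.
  by exists x; apply: val_inj; rewrite /= pE.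
have pU x y : x - y \in U -> p x = p y.
  by rewrite -kq linearB subr_eq0 => /eqP e; apply: val_inj; rewrite /= !pE.
have pK y : p (p^-1%VF y) = y.
  by have [x <-] := sp y; rewrite limg_lfunVK ?memv_img ?memvf.
have Up x y : p x = p y -> x - y \in U.
  by move=> /(congr1 vsval); rewrite !pE -kq linearB subr_eq0 /= => ->.
pose act (v : V) (a : A) : V := p (ract (p^-1%VF v) a).
have actE x a : act (p x) a = p (ract x a).
  by apply: pU; rewrite -ractB; apply/hU/Up; rewrite pK.
have l1 a : linear (act^~ a).
  move=> c u v; have [x <-] := sp u; have [y <-] := sp v.
  by rewrite -linearP !actE ract_linearl linearP.
have l2 v : linear (act v).
  by move=> c a b; rewrite /act ract_linearr linearP.
have a1 v : act v 1 = v by rewrite /act ract1 pK.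
have aM v a b : act v (a * b) = act (act v a) b.
  by have [x <-] := sp v; rewrite !actE ractM.
pose N := @RModule k A V act l1 l2 a1 aM.
exists N, (p : 'Hom(M, N)); split=> //.
apply/vspaceP => x; rewrite memv_ker -kq; apply/eqP/eqP => [e|e].
  by rewrite -pE; move/(congr1 vsval): e.
by apply: val_inj; rewrite /= -[RHS]e -pE.
Qed.

End ModuleHoms.

(** * Endomorphisms of indecomposable modules *)

Section Indecomposable.
Variables (k : fieldType) (A : falgType k).
Implicit Types (X Y Z M N : rmodule A).

Lemma bounded_maximum (P : nat -> Prop) b :
  (exists n, P n) -> (forall n, P n -> (n <= b)%N) ->
  exists2 n, P n & forall m, P m -> (m <= n)%N.
Proof.
move=> [n0 Pn0] bP.
have exP : exists n, (fun n => `[< P n >]) n by exists n0; apply/asboolP.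
have leP n : `[< P n >] -> (n <= b)%N by move/asboolP/bP.
case: (ex_maxnP exP leP) => n /asboolP Pn nP.
by exists n => // m Pm; apply: nP; apply/asboolP.
Qed.

Definition hom_iter M (h : 'Hom(M, M)) n : 'Hom(M, M) :=
  iter n (fun g => h \o g)%VF \1%VF.

Lemma hom_iterS M (h : 'Hom(M, M)) n x :
  hom_iter h n.+1 x = h (hom_iter h n x).
Proof. by rewrite /hom_iter /= comp_lfunE. Qed.

Lemma hom_iterD M (h : 'Hom(M, M)) m n x :
  hom_iter h (m + n) x = hom_iter h m (hom_iter h n x).
Proof.
elim: m => [|m IHm]; first by rewrite /hom_iter /= id_lfunE.
by rewrite addSn !hom_iterS IHm.
Qed.

Lemma rhom_iter M (h : 'Hom(M, M)) n : is_rhom h -> is_rhom (hom_iter h n).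
Proof.
by move=> hh; elim: n => [|n IHn]; [exact: rhom1 | exact: rhom_comp].
Qed.

(** For m large the kernels of the powers of h stabilise, so M is the direct sum
    of the kernel and the image of that power, and one of the two vanishes. *)
Lemma fitting M (h : 'Hom(M, M)) : indecomposable M -> is_rhom h ->
  is_riso h \/ exists n, hom_iter h n = 0.
Proof.
move=> [M0 Mind] hh.
pose P d := exists m, d = \dim (lker (hom_iter h m.+1)).
have [d [m ->] dmax] : exists2 n, P n & forall m, P m -> (m <= n)%N.
  apply: (@bounded_maximum P (\dim (fullv : {vspace M}))).
    by eexists; exists 0%N.
  by move=> n [m ->]; apply: dimvS; apply: subvf.
(* A positive exponent is used so that injectivity of g gives that of h. *)
set g := hom_iter h m.+1 in dmax *.
have kgg x : g (g x) = 0 -> g x = 0.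
  move=> ggx; have sk : (lker g <= lker (hom_iter h (m.+1 + m.+1)))%VS.
    apply/subvP => y; rewrite !memv_ker hom_iterD => /eqP ->.
    by rewrite linear0.
  have /eqP eqk : lker g == lker (hom_iter h (m.+1 + m.+1)).
    rewrite eqEdim sk; apply: dmax; exists (m.+1 + m)%N; by rewrite addnS.
  by apply/eqP; rewrite -memv_ker eqk memv_ker hom_iterD ggx.
have hg : is_rhom g by apply: rhom_iter.
have cap0 : (limg g :&: lker g = 0)%VS.
  apply/eqP; rewrite -subv0; apply/subvP => y /memv_capP[/memv_imgP[x _ ->]].
  by rewrite memv_ker memv0 => /eqP/kgg ->.
have sum1 : (limg g + lker g = fullv)%VS.
  apply/eqP; rewrite eqEdim subvf /= dimv_disjoint_sum //.
  by rewrite addnC -(limg_ker_dim g fullv) capfv.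
case: (Mind _ _ (submodule_img hg) (submodule_ker hg) sum1 cap0) => [g0|k0].
  right; exists m.+1; apply/lfunP => x; rewrite zero_lfunE.
  by apply/eqP; rewrite -memv0 -g0 memv_img ?memvf.
left; apply: riso_endo => // x hx0; apply/eqP; rewrite -memv0 -k0 memv_ker.
by rewrite /g -addn1 hom_iterD hom_iterS /hom_iter /= id_lfunE hx0 linear0.
Qed.

(** Normalising f + g to the identity by u, either u f is invertible or it is
    nilpotent; in the second case g is injective, as x = (u f) x on its kernel. *)
Lemma local_sum M (f g : 'Hom(M, M)) : indecomposable M ->
  is_rhom f -> is_rhom g -> is_riso (f + g) -> is_riso f \/ is_riso g.
Proof.
move=> Mi hf hg /riso_inv[u [isu ufg _]].
have hu := riso_rhom isu.
have [isf|[n nil]] := fitting Mi (rhom_comp hu hf).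
  left; apply: riso_endo => // x fx0; apply: (riso_ker isf).
  by rewrite comp_lfunE fx0 linear0.
right; apply: riso_endo => // x gx0.
have fx : (u \o f)%VF x = x.
  rewrite -[RHS]id_lfunE -ufg !comp_lfunE add_lfunE gx0 addr0 //.
suff -> : x = hom_iter (u \o f)%VF n x by rewrite nil zero_lfunE.
elim: (n) => [|m IHm]; first by rewrite /hom_iter /= id_lfunE.
by rewrite hom_iterS -IHm.
Qed.

(** N is the direct sum of the image of t and the kernel of b, and the first
    is not zero. *)
Lemma split_indec M N (t : 'Hom(M, N)) (b : 'Hom(N, M)) :
    \dim {: M} <> 0%N -> indecomposable N -> is_rhom t -> is_rhom b ->
  (b \o t)%VF = \1%VF -> is_riso t /\ is_riso b.
Proof.
move=> M0 [N0 Nind] ht hb bt1.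
have bt x : b (t x) = x by rewrite -comp_lfunE bt1 id_lfunE.
have cap0 : (limg t :&: lker b = 0)%VS.
  apply/eqP; rewrite -subv0; apply/subvP => y /memv_capP[/memv_imgP[x _ ->]].
  by rewrite memv_ker memv0 bt => /eqP ->; rewrite linear0.
have sum1 : (limg t + lker b = fullv)%VS.
  apply/eqP; rewrite eqEsubv subvf; apply/subvP => y _.
  rewrite -[y](subrK (t (b y))) addrC; apply: memv_add.
    by rewrite memv_img ?memvf.
  by rewrite memv_ker linearB /= bt subrr.
have [t0|b0] := Nind _ _ (submodule_img ht) (submodule_ker hb) sum1 cap0.
  case: M0; apply/eqP; rewrite dimv_eq0 -subv0; apply/subvP => x _.
  rewrite memv0 -[x]bt.
  have : t x \in limg t by rewrite memv_img ?memvf.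
  by rewrite t0 memv0 => /eqP ->; rewrite linear0.
have tb y : t (b y) = y.
  apply/eqP; rewrite -subr_eq0 -memv0 -b0 memv_ker linearB /= bt subrr //.
by split; split=> //; [exists b | exists t]; split=> //; apply/lfunP => y;
  rewrite comp_lfunE id_lfunE ?tb ?bt.
Qed.

Lemma indec_dim M : indecomposable M -> \dim {: M} <> 0%N.
Proof. by case. Qed.

(** Pre- or post-composing with the inverse of the composite exhibits t and b as
    a split monomorphism into, and a split epimorphism from, an indecomposable. *)
Lemma riso_factor M X N (t : 'Hom(M, X)) (b : 'Hom(X, N)) :
    indecomposable X -> \dim {: M} <> 0%N -> is_rhom t -> is_rhom b ->
  is_riso (b \o t)%VF -> is_riso t /\ is_riso b.
Proof.
move=> Xi M0 ht hb /riso_inv[c [isc cbt btc]].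
have hc := riso_rhom isc.
rewrite comp_lfunA in cbt.
have [ist isb] := split_indec M0 Xi ht (rhom_comp hc hb) cbt.
split=> //; have [c' [isc' c'c _]] := riso_inv isc.
by rewrite -[b]comp_lfun1l -c'c -comp_lfunA; apply: riso_comp.
Qed.

Lemma local_big_sum M N I (s : seq I) (f : I -> 'Hom(M, N)) : indecomposable M ->
  (forall i, is_rhom (f i)) -> is_riso (\sum_(i <- s) f i) ->
  exists i, is_riso (f i).
Proof.
move=> Mi hf; elim: s => [|i s IHs].
  rewrite big_nil => is0; case: (indec_dim Mi).
  apply/eqP; rewrite dimv_eq0 -subv0; apply/subvP => x _; rewrite memv0.
  by apply/eqP/(riso_ker is0); rewrite zero_lfunE.
rewrite big_cons => iss.
have [c [isc cf fc]] := riso_inv iss.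
have hc := riso_rhom isc.
have back (g : 'Hom(M, N)) : is_riso (c \o g)%VF -> is_riso g.
  have [c' [isc' c'c _]] := riso_inv isc.
  by move=> iscg; have := riso_comp isc' iscg; rewrite comp_lfunA c'c comp_lfun1l.
have : is_riso ((c \o f i) + (c \o \sum_(j <- s) f j))%VF.
  by rewrite -comp_lfunDr cf; apply: riso1.
case/local_sum=> //; do ?[by apply: rhom_comp => //; apply: rhom_sum].
  by move/back; exists i.
by move/back/IHs.
Qed.

End Indecomposable.

(** * Finite direct sums *)

Section DirectSums.
Variables (k : fieldType) (A : falgType k) (r : nat) (M : 'I_r -> rmodule A).
Implicit Types (X Y : rmodule A).

Lemma dsum_ract (v : dsum M) a i :
  (ract v a : dprod M) i = ract ((v : dprod M) i) a.
Proof. exact: dprodE. Qed.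

Definition dsum_inj i : 'Hom(M i, dsum M) :=
  dsum_col (dfwith (T := fun j => 'Hom(M i, M j)) (fun=> 0) \1%VF).

Definition dsum_proj i : 'Hom(dsum M, M i) :=
  dsum_row (dfwith (T := fun j => 'Hom(M j, M i)) (fun=> 0) \1%VF).

Lemma dsum_projE i (v : dsum M) : dsum_proj i v = (v : dprod M) i.
Proof.
rewrite dsum_rowE (bigD1 i) //= dfwith_in id_lfunE big1 ?addr0 // => j ji.
by rewrite dfwith_out 1?eq_sym // zero_lfunE.
Qed.

Lemma dsum_projK (u v : dsum M) :
  (forall i, dsum_proj i u = dsum_proj i v) -> u = v.
Proof. by move=> e; apply/dprodP => i; have := e i; rewrite !dsum_projE. Qed.

Lemma rhom_dsum_col X (f : forall i, 'Hom(X, M i)) :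
  (forall i, is_rhom (f i)) -> is_rhom (dsum_col f).
Proof.
move=> hf x a; apply/dprodP => i.
by rewrite dsum_ract !dsum_colE hf.
Qed.

Lemma rhom_dsum_row Y (f : forall i, 'Hom(M i, Y)) :
  (forall i, is_rhom (f i)) -> is_rhom (dsum_row f).
Proof.
move=> hf v a; rewrite !dsum_rowE.
rewrite ract_sum; apply: eq_bigr => i _.
by rewrite dsum_ract hf.
Qed.

Lemma rhom_dsum_inj i : is_rhom (dsum_inj i).
Proof.
apply: rhom_dsum_col => j.
by case: dfwithP => [|l _]; [exact: rhom1 | exact: rhom0].
Qed.

Lemma rhom_dsum_proj i : is_rhom (dsum_proj i).
Proof.
apply: rhom_dsum_row => j.
by case: dfwithP => [|l _]; [exact: rhom1 | exact: rhom0].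
Qed.

Lemma dsum_proj_col X (f : forall i, 'Hom(X, M i)) i :
  (dsum_proj i \o dsum_col f)%VF = f i.
Proof. by apply/lfunP => x; rewrite comp_lfunE dsum_projE dsum_colE. Qed.

Lemma dsum_row_inj Y (f : forall i, 'Hom(M i, Y)) i :
  (dsum_row f \o dsum_inj i)%VF = f i.
Proof.
apply/lfunP => x; rewrite comp_lfunE dsum_rowE (bigD1 i) //= big1 => [|j ji].
  by rewrite dsum_colE dfwith_in id_lfunE addr0.
by rewrite dsum_colE dfwith_out 1?eq_sym // zero_lfunE linear0.
Qed.

Lemma dsum_row_col X Y (f : forall i, 'Hom(M i, Y)) (g : forall i, 'Hom(X, M i)) :
  (dsum_row f \o dsum_col g)%VF = \sum_i (f i \o g i)%VF.
Proof.
apply/lfunP => x; rewrite comp_lfunE dsum_rowE sum_lfunE.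
by apply: eq_bigr => i _; rewrite dsum_colE comp_lfunE.
Qed.

Lemma dsum_row_sum Y (f : forall i, 'Hom(M i, Y)) :
  dsum_row f = \sum_i (f i \o dsum_proj i)%VF.
Proof.
apply/lfunP => v; rewrite dsum_rowE sum_lfunE.
by apply: eq_bigr => i _; rewrite comp_lfunE dsum_projE.
Qed.

Lemma dsum_col_proj X (u : 'Hom(X, dsum M)) :
  u = dsum_col (fun i => dsum_proj i \o u)%VF.
Proof.
apply/lfunP => x; apply: dsum_projK => i.
by rewrite !dsum_projE dsum_colE comp_lfunE dsum_projE.
Qed.

Lemma dsum_col_sum X (f : forall i, 'Hom(X, M i)) :
  dsum_col f = \sum_i (dsum_inj i \o f i)%VF.
Proof.
apply/lfunP => x; apply: dsum_projK => i; rewrite dsum_projE dsum_colE.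
rewrite sum_lfunE linear_sum (bigD1 i) //= big1 => [|j ji].
  by rewrite comp_lfunE dsum_projE dsum_colE dfwith_in id_lfunE addr0.
by rewrite comp_lfunE dsum_projE dsum_colE dfwith_out ?zero_lfunE.
Qed.

Lemma rhom_row_component Y (f : forall i, 'Hom(M i, Y)) i :
  is_rhom (dsum_row f) -> is_rhom (f i).
Proof.
move=> hf; rewrite -(dsum_row_inj f i).
exact (rhom_comp hf (@rhom_dsum_inj i)).
Qed.

Lemma rhom_col_component X (f : forall i, 'Hom(X, M i)) i :
  is_rhom (dsum_col f) -> is_rhom (f i).
Proof.
move=> hf; rewrite -(dsum_proj_col f i).
exact (rhom_comp (@rhom_dsum_proj i) hf).
Qed.

End DirectSums.

Arguments dsum_inj {k A r M} i.
Arguments dsum_proj {k A r M} i.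

(** * Decomposition into indecomposables and the radical *)

Section Decomposition.
Variables (k : fieldType) (A : falgType k).
Implicit Types (X Y M N U : rmodule A).

(** A candidate direct summand of M, given by its inclusion and projection maps;
    sequences of these can be concatenated, which families indexed by ordinals
    cannot without transport. *)
Definition summand M := {N : rmodule A & ('Hom(N, M) * 'Hom(M, N))%type}.
Definition summandP M (t : summand M) : Prop :=
  [/\ indecomposable (projT1 t), is_rhom (projT2 t).1 & is_rhom (projT2 t).2].

Lemma complement_split M (U V : {vspace M}) : is_submodule U -> is_submodule V ->
    (U + V = fullv)%VS -> (U :&: V = 0)%VS ->
  exists (N : rmodule A) (i : 'Hom(N, M)) (p : 'Hom(M, N)),
    [/\ is_rhom i, is_rhom p, (p \o i)%VF = \1%VF, dim N = \dim U
      & forall x, i (p x) = daddv_pi U V x].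
Proof.
move=> hU hV UV1 UV0; have [N [i [hi ki Ui]]] := submodule_inclusion hU.
have VU0 : (V :&: U = 0)%VS by rewrite capvC.
have piD x : daddv_pi U V x + daddv_pi V U x = x.
  by apply: daddv_pi_add; rewrite ?UV1 ?memvf.
have piE u v : u \in U -> v \in V -> daddv_pi U V (u + v) = u.
  move=> uU vV; rewrite linearD /= (daddv_pi_id UV0 uU).
  suff -> : daddv_pi U V v = 0 by rewrite addr0.
  by apply: (@addIr _ (daddv_pi V U v)); rewrite piD (daddv_pi_id VU0 vV) add0r.
have hpi : is_rhom (daddv_pi U V : 'Hom(M, M)).
  move=> x a; rewrite -{1}[x]piD ractD piE //.
    by apply/hU/memv_pi.
  by apply/hV/memv_pi.
have injU x : exists y, i y = daddv_pi U V x.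
  have : daddv_pi U V x \in limg i by rewrite Ui memv_pi.
  by case/memv_imgP => y _ ->; exists y.
have [|p [hp pE]] := factor_through hi (@rhom1 _ _ N) hpi _ injU.
  by move=> y /ki ->; rewrite linear0.
exists N, i, p; split=> //.
- apply/lfunP => y; rewrite comp_lfunE (pE y) //.
  by rewrite daddv_pi_id // -Ui memv_img ?memvf.
- rewrite -Ui limg_dim_eq ?dimvf //; apply/eqP; rewrite -subv0.
  by apply/subvP => y; rewrite capfv memv_ker memv0 => /eqP/ki ->.
by move=> x; have [y yx] := injU x; rewrite (pE y) ?id_lfunE.
Qed.

Lemma decomposition_summand M N (i : 'Hom(N, M)) (p : 'Hom(M, N)) (s : seq (summand N)) :
    is_rhom i -> is_rhom p -> all (fun t => `[< summandP t >]) s ->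
    \sum_(t <- s) ((projT2 t).1 \o (projT2 t).2)%VF = \1%VF ->
  exists s' : seq (summand M),
  [/\ all (fun t => `[< summandP t >]) s',
      \sum_(t <- s') ((projT2 t).1 \o (projT2 t).2)%VF = (i \o p)%VF
    & (\sum_(t <- s') dim (projT1 t) = \sum_(t <- s) dim (projT1 t))%N].
Proof.
move=> hi hp hs s1.
exists [seq existT (fun L : rmodule A => 'Hom(L, M) * 'Hom(M, L))%type (projT1 t)
  (i \o (projT2 t).1, (projT2 t).2 \o p)%VF | t <- s]; split.
- rewrite all_map; apply: sub_all hs => t /asboolP[Ni h1 h2] /=.
  by apply/asboolP; split=> //=; apply: rhom_comp.
- have ip : ((i \o \1) \o p = i \o p)%VF by rewrite comp_lfun1r.
  rewrite big_map -{}ip -s1 comp_lfun_sumr comp_lfun_suml.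
  by apply: eq_bigr => t _; rewrite /= !comp_lfunA.
- by rewrite big_map.
Qed.

(** By induction on the dimension.  The conditions (sum of the phi psi equal to 1,
    and dimensions adding up) suffice for a direct sum decomposition and, unlike
    orthogonality of the summands, are inherited by concatenation. *)
Lemma decomposition_seq M : exists s : seq (summand M),
  [/\ all (fun t => `[< summandP t >]) s,
      \sum_(t <- s) ((projT2 t).1 \o (projT2 t).2)%VF = \1%VF
    & (\sum_(t <- s) dim (projT1 t))%N = dim M].
Proof.
have [n] := ubnP (dim M); elim: n M => // n IHn M /ltnSE-leM.
have [M0|Mn0] := eqVneq (dim M) 0%N.
  exists [::]; split=> //; rewrite ?big_nil //; apply/lfunP => x.
  rewrite zero_lfunE id_lfunE; apply/esym/eqP; rewrite -memv0.
  suff <- : fullv = 0%VS :> {vspace M} by apply: memvf.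
  by apply/eqP; rewrite -dimv_eq0 dimvf M0.
have [Mi|nMi] := pselect (indecomposable M).
  exists [:: existT _ M (\1%VF, \1%VF)]; rewrite /= !big_seq1 /= comp_lfun1l.
  split=> //; rewrite andbT; apply/asboolP; split=> //; exact: rhom1.
have [U [V [hU hV UV1 UV0 [U0 V0]]]] : exists U V : {vspace M},
    [/\ is_submodule U, is_submodule V, (U + V = fullv)%VS, (U :&: V = 0)%VS
      & U <> 0%VS /\ V <> 0%VS].
  apply: contra_notP nMi => nUV; split; first by rewrite dimvf; apply/eqP.
  move=> U V hU hV UV1 UV0; apply: contrapT => /not_orP UV.
  by apply: nUV; exists U, V.
have dUV : (\dim U + \dim V = dim M)%N.
  by rewrite -dimv_disjoint_sum // UV1 dimvf.
have dgt0 (W : {vspace M}) : W <> 0%VS -> (0 < \dim W)%N.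
  by move=> W0; rewrite lt0n dimv_eq0; apply/eqP.
have [NU [iU [pU [hiU hpU piU dNU pUE]]]] := complement_split hU hV UV1 UV0.
have [NV [iV [pV [hiV hpV piV dNV pVE]]]] :
    exists (N : rmodule A) (i : 'Hom(N, M)) (p : 'Hom(M, N)),
    [/\ is_rhom i, is_rhom p, (p \o i)%VF = \1%VF, dim N = \dim V
      & forall x, i (p x) = daddv_pi V U x].
  by apply: complement_split => //; rewrite ?(addvC V) ?(capvC V).
have [|sU [aU tU dU]] := IHn NU.
  by apply: leq_trans leM; rewrite dNU -dUV -[X in (X < _)%N]addn0 ltn_add2l dgt0.
have [|sV [aV tV dV]] := IHn NV.
  by apply: leq_trans leM; rewrite dNV -dUV -[X in (X < _)%N]add0n ltn_add2r dgt0.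
have [sU' [aU' tU' dU']] := decomposition_summand hiU hpU aU tU.
have [sV' [aV' tV' dV']] := decomposition_summand hiV hpV aV tV.
exists (sU' ++ sV'); split.
- by rewrite all_cat aU' aV'.
- rewrite big_cat /= tU' tV'; apply/lfunP => x.
  rewrite add_lfunE !comp_lfunE pUE pVE id_lfunE.
  by apply: daddv_pi_add; rewrite ?UV1 ?memvf.
- by rewrite big_cat /= dU' dV' dU dV dNU dNV.
Qed.

Lemma decomposition M : exists r (N : 'I_r -> rmodule A)
    (phi : forall i, 'Hom(N i, M)) (psi : forall i, 'Hom(M, N i)),
  [/\ forall i, indecomposable (N i), is_riso (dsum_row phi) & is_riso (dsum_col psi)].
Proof.
have [s [alls ts ds]] := decomposition_seq M.
pose t0 : summand M := existT _ M (\1%VF, \1%VF).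
pose N (i : 'I_(size s)) := projT1 (nth t0 s i).
pose phi i : 'Hom(N i, M) := (projT2 (nth t0 s i)).1.
pose psi i : 'Hom(M, N i) := (projT2 (nth t0 s i)).2.
have hs i : [/\ indecomposable (N i), is_rhom (phi i) & is_rhom (psi i)].
  by apply/asboolP; move/(all_nthP t0): alls => /(_ i (ltn_ord i)).
have dN : dim (dsum N) = dim M by rewrite -ds (big_nth t0) big_mkord.
have one : (dsum_row phi \o dsum_col psi)%VF = \1%VF.
  by rewrite dsum_row_col -ts [RHS](big_nth t0) big_mkord.
have oneE x : dsum_row phi (dsum_col psi x) = x by rewrite -comp_lfunE one id_lfunE.
exists (size s), N, phi, psi; split=> [i||]; first by case: (hs i).
  apply: riso_surj; rewrite ?dN //; last by move=> x; exists (dsum_col psi x).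
  by apply: rhom_dsum_row => i; case: (hs i).
apply: riso_inj; rewrite ?dN //; last by move=> x x0; rewrite -[x]oneE x0 linear0.
by apply: rhom_dsum_col => i; case: (hs i).
Qed.

(** The radical described without reference to chosen decompositions: by
    [radicalP] it is the same notion, and the ideal properties are then
    immediate. *)
Definition nowhere_iso X Y (f : 'Hom(X, Y)) : Prop :=
  is_rhom f /\ forall M N (a : 'Hom(M, X)) (b : 'Hom(Y, N)),
    indecomposable M -> indecomposable N -> is_rhom a -> is_rhom b ->
    ~ is_riso (b \o f \o a)%VF.

(** Writing the test maps a and b in components along the given decompositions,
    an isomorphism b f a is a sum of maps factoring through the components of f;
    since End M is local one summand is an isomorphism, and then so is the
    component of f it passes through. *)
Lemma radicalP X Y (f : 'Hom(X, Y)) : radical f <-> nowhere_iso f.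
Proof.
split=> [[hf [r [s [M [N [phi [psi [Mi Ni isphi ispsi nis]]]]]]]]|[hf nis]]; last first.
  split=> //; have [r [M [phi [_ [Mi isphi _]]]]] := decomposition X.
  have [s [N [_ [psi [Ni _ ispsi]]]]] := decomposition Y.
  exists r, s, M, N, phi, psi; split=> // i j; apply: nis => //.
    exact: rhom_row_component (riso_rhom isphi).
  exact: rhom_col_component (riso_rhom ispsi).
split=> // K L a b Ki Li ha hb isbfa.
have hphi i : is_rhom (phi i).
  exact: rhom_row_component (riso_rhom isphi).
have hpsi i : is_rhom (psi i).
  exact: rhom_col_component (riso_rhom ispsi).
have [p [isp _ phip]] := riso_inv isphi; have [q [isq qpsi _]] := riso_inv ispsi.
have hp := riso_rhom isp; have hq := riso_rhom isq.
pose a' i := (dsum_proj i \o (p \o a))%VF.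
pose b' j := ((b \o q) \o dsum_inj j)%VF.
have ha' i : is_rhom (a' i) by apply: rhom_comp (@rhom_dsum_proj _ _ _ _ i) (rhom_comp hp ha).
have hb' j : is_rhom (b' j) by apply: rhom_comp (rhom_comp hb hq) (@rhom_dsum_inj _ _ _ _ j).
have aE : a = \sum_i (phi i \o a' i)%VF.
  rewrite -[a]comp_lfun1l -phip dsum_row_sum comp_lfun_suml comp_lfun_suml.
  by apply: eq_bigr => i _; rewrite /a' !comp_lfunA.
have bE : b = \sum_j (b' j \o psi j)%VF.
  rewrite -[b]comp_lfun1r -qpsi dsum_col_sum !comp_lfun_sumr.
  by apply: eq_bigr => i _; rewrite /b' !comp_lfunA.
move: isbfa; rewrite aE comp_lfun_sumr => isbfa.
have [|i isi] := local_big_sum Ki _ isbfa.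
  by move=> i; do 2![apply: rhom_comp => //]; apply: rhom_comp.
move: isi; rewrite bE !comp_lfun_suml => isi.
have [|j isj] := local_big_sum Ki _ isi.
  by move=> j; do 3![apply: rhom_comp => //].
case: (nis i j); move: isj.
have -> : (((b' j \o psi j) \o f) \o (phi i \o a' i) = 
  b' j \o (((psi j \o f) \o phi i) \o a' i))%VF by rewrite !comp_lfunA.
have K0 := indec_dim Ki.
case/riso_factor => //; do ?[by do ?[apply: rhom_comp => //]].
by case/riso_factor => //; do ?[by do ?[apply: rhom_comp => //]].
Qed.

End Decomposition.

(** * Powers of the radical *)

Section RadicalPowers.
Variables (k : fieldType) (A : falgType k).
Implicit Types (X Y Z M N U E C K T : rmodule A).

Lemma radical_rhom X Y (f : 'Hom(X, Y)) : radical f -> is_rhom f.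
Proof. by case. Qed.

Lemma radical_compl X Y Z (b : 'Hom(Y, Z)) (f : 'Hom(X, Y)) :
  is_rhom b -> radical f -> radical (b \o f)%VF.
Proof.
move=> hb /radicalP[hf nis]; apply/radicalP; split; first exact: rhom_comp.
move=> M N a c Mi Ni ha hc; rewrite (comp_lfunA c).
by apply: nis => //; apply: rhom_comp.
Qed.

Lemma radical_compr X Y Z (f : 'Hom(Y, Z)) (a : 'Hom(X, Y)) :
  radical f -> is_rhom a -> radical (f \o a)%VF.
Proof.
move=> /radicalP[hf nis] ha; apply/radicalP; split; first exact: rhom_comp.
move=> M N c b Mi Ni hc hb; rewrite comp_lfunA -(comp_lfunA _ a).
by apply: nis => //; apply: rhom_comp.
Qed.

Lemma radicalD X Y (f g : 'Hom(X, Y)) :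
  radical f -> radical g -> radical (f + g).
Proof.
move=> /radicalP[hf nf] /radicalP[hg ng]; apply/radicalP; split; first exact: rhomD.
move=> M N a b Mi Ni ha hb; rewrite comp_lfunDr comp_lfunDl.
pose F (i : bool) := (if i then b \o f \o a else b \o g \o a)%VF.
have -> : (((b \o f) \o a) + ((b \o g) \o a))%VF = \sum_(i <- [:: true; false]) F i.
  by rewrite big_cons big_seq1.
case/local_big_sum => // [i|[]]; last by apply: ng.
  by case: i; do 2![apply: rhom_comp => //].
exact: nf.
Qed.

Lemma radical0 X Y : radical (0 : 'Hom(X, Y)).
Proof.
apply/radicalP; split=> [|M N a b Mi Ni ha hb]; first exact: rhom0.
rewrite comp_lfun0r comp_lfun0l => is0; case: (indec_dim Mi).
apply/eqP; rewrite dimv_eq0 -subv0; apply/subvP => x _; rewrite memv0.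
by apply/eqP/(riso_ker is0); rewrite zero_lfunE.
Qed.

Lemma radical_indec X Y (f : 'Hom(X, Y)) :
  indecomposable X -> indecomposable Y -> is_rhom f -> radical f \/ is_riso f.
Proof.
move=> Xi Yi hf; have [isf|nisf] := pselect (is_riso f); [by right|left].
apply/radicalP; split=> // M N a b Mi Ni ha hb isbfa; apply: nisf.
have M0 := indec_dim Mi.
case/riso_factor: isbfa => //; first exact: rhom_comp.
move=> /riso_inv[c [isc ca ac]] isbf.
by have X0 := indec_dim Xi; case/riso_factor: isbf.
Qed.

Lemma radical_not_riso X Y (f : 'Hom(X, Y)) :
  indecomposable X -> indecomposable Y -> radical f -> ~ is_riso f.
Proof.
move=> Xi Yi /radicalP[hf nis] isf.
apply: (nis X Y \1%VF \1%VF) => //; try exact: rhom1.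
by rewrite comp_lfun1l comp_lfun1r.
Qed.

Lemma rad_pow0 n X Y : rad_pow n (0 : 'Hom(X, Y)).
Proof.
case: n => [|[|n]]; [exact: rhom0 | exact: radical0 |].
exists 0%N, (fun=> X), (fun=> 0), (fun=> 0).
by split=> [[]|[]|]; rewrite ?big_ord0.
Qed.

Lemma rad_powS n X Y Z (h : 'Hom(Z, Y)) (g : 'Hom(X, Z)) :
  radical g -> rad_pow n h -> rad_pow n.+1 (h \o g)%VF.
Proof.
case: n => [|n] hg hh; first exact: radical_compl.
exists 1%N, (fun=> Z), (fun=> g), (fun=> h).
by split=> //; rewrite big_ord1.
Qed.

Lemma rad_powD n X Y (f g : 'Hom(X, Y)) :
  rad_pow n f -> rad_pow n g -> rad_pow n (f + g).
Proof.
case: n => [|[|n]]; [exact: rhomD | exact: radicalD |].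
move=> [r1 [Z1 [g1 [h1 [rg1 rh1 ->]]]]] [r2 [Z2 [g2 [h2 [rg2 rh2 ->]]]]].
pose Z (o : 'I_r1 + 'I_r2) := match o with inl i => Z1 i | inr i => Z2 i end.
pose gg o : 'Hom(X, Z o) := match o with inl i => g1 i | inr i => g2 i end.
pose hh o : 'Hom(Z o, Y) := match o with inl i => h1 i | inr i => h2 i end.
exists (r1 + r2)%N, (fun i => Z (split i)), (fun i => gg (split i)), (fun i => hh (split i)).
split=> [i|i|]; [by case: split | by case: split |].
rewrite big_split_ord /=; pose F o := (hh o \o gg o)%VF.
congr (_ + _); apply: eq_bigr => i _.
  by rewrite -[RHS]/(F (split (unsplit (inl i)))) unsplitK.
by rewrite -[RHS]/(F (split (unsplit (inr i)))) unsplitK.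
Qed.

Lemma rad_pow_sum n X Y I (s : seq I) (P : pred I) (f : I -> 'Hom(X, Y)) :
  (forall i, P i -> rad_pow n (f i)) -> rad_pow n (\sum_(i <- s | P i) f i).
Proof.
by move=> hf; elim/big_rec: _ => [|i g Pi]; [exact: rad_pow0 | apply/rad_powD/hf].
Qed.

Lemma rad_pow_compl n X Y Z (b : 'Hom(Y, Z)) (f : 'Hom(X, Y)) :
  is_rhom b -> rad_pow n f -> rad_pow n (b \o f)%VF.
Proof.
move=> hb; elim: n X f => [|n IHn] X f; first exact: rhom_comp hb.
case: n IHn => [_|n IHn]; first exact: radical_compl hb.
move=> [r [V [g [h [rg rh ->]]]]]; rewrite comp_lfun_sumr.
exists r, V, g, (fun i => b \o h i)%VF; split=> // [i|]; first exact: IHn (rh i).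
by apply: eq_bigr => i _; rewrite comp_lfunA.
Qed.

Lemma rad_powZ n X Y c (f : 'Hom(X, Y)) : rad_pow n f -> rad_pow n (c *: f).
Proof.
move=> nf; rewrite -[f]comp_lfun1l comp_lfunZl; apply: rad_pow_compl => //.
exact/rhomZ/rhom1.
Qed.

Lemma rad_powB n X Y (f g : 'Hom(X, Y)) :
  rad_pow n f -> rad_pow n g -> rad_pow n (f - g).
Proof. by move=> nf ng; rewrite -scaleN1r; apply/rad_powD/rad_powZ. Qed.

(** The powers are defined by peeling off radical maps at the source; this is the
    same step at the target. *)
Lemma rad_powSl n X Y Z (h : 'Hom(Z, Y)) (g : 'Hom(X, Z)) :
  radical h -> rad_pow n g -> rad_pow n.+1 (h \o g)%VF.
Proof.
move=> rh; elim: n X g => [|n IHn] X g; first exact: radical_compr.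
case: n IHn => [|n] IHn; first by move=> rg; apply: rad_powS.
move=> [r [V [a [b [ra rb ->]]]]]; rewrite comp_lfun_sumr.
apply: rad_pow_sum => i _; rewrite comp_lfunA.
exact: rad_powS (ra i) (IHn _ _ (rb i)).
Qed.

Lemma rad_pow_pred n X Y (f : 'Hom(X, Y)) : rad_pow n.+1 f -> rad_pow n f.
Proof.
elim: n X f => [|n IHn] X f; first exact: radical_rhom.
move=> [r [V [g [h [rg rh ->]]]]]; apply: rad_pow_sum => i _.
exact: rad_powS (rg i) (IHn _ _ (rh i)).
Qed.

Lemma rad_pow_le m n X Y (f : 'Hom(X, Y)) :
  (m <= n)%N -> rad_pow n f -> rad_pow m f.
Proof.
move=> /subnK <-; elim: (n - m)%N => // d IHd.
by rewrite addSn => /rad_pow_pred.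
Qed.

Lemma rad_pow_rhom n X Y (f : 'Hom(X, Y)) : rad_pow n f -> is_rhom f.
Proof. exact: (@rad_pow_le 0). Qed.

(** A subspace of maximal dimension among those on which P holds is all of P. *)
Lemma linear_pred_vspace (V : vectType k) (P : V -> Prop) : P 0 ->
    (forall c u v, P u -> P v -> P (c *: u + v)) ->
  exists W : {vspace V}, forall v, v \in W <-> P v.
Proof.
move=> P0 PL.
pose D d := exists W : {vspace V}, d = \dim W /\ forall v, v \in W -> P v.
have [_ [W [-> WP]] Wmax] : exists2 n, D n & forall m, D m -> (m <= n)%N.
  apply: (@bounded_maximum D (\dim (fullv : {vspace V}))).
    by exists 0%N, 0%VS; rewrite dimv0; split=> // v; rewrite memv0 => /eqP ->.
  by move=> n [W [-> _]]; apply: dimvS; apply: subvf.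
exists W => v; split=> [/WP //|Pv].
have WvP : D (\dim (W + <[v]>)%VS).
  exists (W + <[v]>)%VS; split=> // _ /memv_addP[u uW [_ /vlineP[c ->] ->]].
  by rewrite addrC; apply: PL => //; apply: WP.
have : (W == W + <[v]>)%VS by rewrite eqEdim addvSl Wmax.
by move/eqP->; apply: (subvP (addvSr _ _)); apply: memv_line.
Qed.

(** The powers rad^n(X, Y) form a decreasing chain of subspaces of the
    finite-dimensional space Hom(X, Y). *)
Lemma rad_pow_stable X Y : exists n, forall f : 'Hom(X, Y),
  rad_pow n f -> rad_infty f.
Proof.
have VP n := linear_pred_vspace (rad_pow0 n X Y)
  (fun c u v pu pv => rad_powD (rad_powZ c pu) pv).
pose W n := projT1 (cid (VP n)).
have WP n f : f \in W n <-> rad_pow n f by rewrite /W; case: (cid _) => /= U.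
pose b := \dim (fullv : {vspace 'Hom(X, Y)}).
have [d [n dE] dmax] : exists2 d, exists n, d = (b - \dim (W n))%N
    & forall m, (exists n, m = (b - \dim (W n))%N) -> (m <= d)%N.
  apply: (@bounded_maximum _ b); first by eexists; exists 0%N.
  by move=> _ [n ->]; apply: leq_subr.
exists n => f nf m; case: (leqP m n) => [/rad_pow_le|/ltnW lenm]; first exact.
have sWW : (W m <= W n)%VS.
  by apply/subvP => g /WP/(rad_pow_le lenm)/WP.
have /eqP eW : W m == W n.
  rewrite eqEdim sWW /=; have := dmax _ (ex_intro _ m erefl); rewrite dE.
  by rewrite leq_sub2lE //; apply: dimvS; apply: subvf.
by apply/WP; rewrite eW; apply/WP.
Qed.

(** In each product it is the radical factor ending at Y that is lifted along g. *)
Lemma rad_pow_factor_right n X Y E (g : 'Hom(E, Y)) (f : 'Hom(X, Y)) :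
    right_almost_split g -> rad_pow n.+1 f ->
  exists h : 'Hom(X, E), rad_pow n h /\ f = (g \o h)%VF.
Proof.
move=> [rg Yi gas]; elim: n X f => [|n IHn] X f; first exact: gas.
move=> [r [V [a [b [ra rb ->]]]]].
have bE i : exists h : 'Hom(V i, E), rad_pow n h /\ b i = (g \o h)%VF by apply: IHn (rb i).
pose h i := projT1 (cid (bE i)).
have hE i : rad_pow n (h i) /\ b i = (g \o h i)%VF by rewrite /h; case: (cid _).
exists (\sum_i (h i \o a i))%VF; split.
  by apply: rad_pow_sum => i _; apply: rad_powS => //; case: (hE i).
by rewrite comp_lfun_sumr; apply: eq_bigr => i _; rewrite comp_lfunA; case: (hE i) => _ <-.
Qed.

End RadicalPowers.

(** * Exactness of almost split pairs *)

Section AlmostSplit.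
Variables (k : fieldType) (A : falgType k).
Implicit Types (X Y Z M N U E C K T : rmodule A).

Lemma proper_submodule_radical N Y (i : 'Hom(N, Y)) :
  indecomposable Y -> is_rhom i -> limg i <> fullv -> radical i.
Proof.
move=> Yi hi ni; apply/radicalP; split=> // M L a b Mi Li ha hb isb; apply: ni.
move: isb; rewrite -comp_lfunA => isb.
case/riso_factor: isb => //; [exact: indec_dim | exact: rhom_comp |].
move=> [_ [c [hc _ iac]]] _; apply/eqP; rewrite eqEsubv subvf; apply/subvP => y _.
rewrite -[y]id_lfunE -iac -comp_lfunA !comp_lfunE; apply: memv_img; exact: memvf.
Qed.

(** If g is not onto, the inclusion i of its image is radical, so i = g u; writing
    g = i p gives g (u p) = g, and minimality makes u p, hence g, injective. *)
Lemma right_minimal_almost_split_cases E Y (g : 'Hom(E, Y)) :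
  right_minimal g -> right_almost_split g ->
  limg g = fullv \/ forall x, g x = 0 -> x = 0.
Proof.
move=> [hg gmin] [rg Yi gas].
have [gs|ngs] := pselect (limg g = fullv); [by left | right].
have [N [i [hi ki iI]]] := submodule_inclusion (submodule_img hg).
have [|u [hu iu]] := gas N i.
  by apply: proper_submodule_radical; rewrite ?iI.
have gi x : exists y, i y = g x.
  have : g x \in limg i by rewrite iI memv_img ?memvf.
  by case/memv_imgP => y _ ->; exists y.
have [|p [hp pE]] := factor_through hi (@rhom1 _ _ N) hg _ gi.
  by move=> y /ki ->; rewrite linear0.
have isup : is_riso (u \o p)%VF.
  apply: gmin; first exact: rhom_comp.
  apply/lfunP => x; rewrite comp_lfunA -iu comp_lfunE.
  by have [y yx] := gi x; rewrite (pE y) // id_lfunE.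
move=> x gx0; apply: (riso_ker isup); rewrite comp_lfunE (pE 0) ?linear0 //.
Qed.

Lemma nonradical_split_mono T K (f : 'Hom(T, K)) : indecomposable T -> is_rhom f ->
  ~ radical f -> exists r : 'Hom(K, T), is_rhom r /\ (r \o f)%VF = \1%VF.
Proof.
move=> Ti hf nrf; have [M [N [a [b [Mi Ni ha hb isb]]]]] :
    exists M N (a : 'Hom(M, T)) (b : 'Hom(K, N)),
    [/\ indecomposable M, indecomposable N, is_rhom a, is_rhom b
      & is_riso (b \o f \o a)%VF].
  apply: contra_notP nrf => nex; apply/radicalP; split=> // M N a b Mi Ni ha hb isb.
  by apply: nex; exists M, N, a, b.
have [c [isc cbfa _]] := riso_inv isb.
have M0 := indec_dim Mi.
case/riso_factor: isb => //; first exact: rhom_comp.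
move=> /riso_inv[a' [_ a'a aa']] _.
exists (a \o (c \o b))%VF; split.
  by apply: rhom_comp => //; apply: rhom_comp => //; apply: riso_rhom.
have -> : ((a \o (c \o b)) \o f = (a \o (c \o ((b \o f) \o a))) \o a')%VF.
  by rewrite !comp_lfunA -[RHS]comp_lfunA aa' comp_lfun1r.
by rewrite cbfa comp_lfun1r.
Qed.

Lemma nonradical_split_epi C Y (g : 'Hom(C, Y)) : indecomposable Y -> is_rhom g ->
  ~ radical g -> exists s : 'Hom(Y, C), is_rhom s /\ (g \o s)%VF = \1%VF.
Proof.
move=> Yi hg nrg; have [M [N [a [b [Mi Ni ha hb isb]]]]] :
    exists M N (a : 'Hom(M, C)) (b : 'Hom(Y, N)),
    [/\ indecomposable M, indecomposable N, is_rhom a, is_rhom b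
      & is_riso (b \o g \o a)%VF].
  apply: contra_notP nrg => nex; apply/radicalP; split=> // M N a b Mi Ni ha hb isb.
  by apply: nex; exists M, N, a, b.
have [c [isc _ bgac]] := riso_inv isb.
have M0 := indec_dim Mi.
move: isb; rewrite -comp_lfunA => isb.
case/riso_factor: isb => //; first exact: rhom_comp.
move=> _ /riso_inv[b' [_ b'b bb']].
exists (a \o (c \o b))%VF; split.
  by apply: rhom_comp => //; apply: rhom_comp => //; apply: riso_rhom.
have -> : (g \o (a \o (c \o b)) = b' \o ((((b \o g) \o a) \o c) \o b))%VF.
  by rewrite !comp_lfunA b'b comp_lfun1l.
by rewrite bgac comp_lfun1l.
Qed.

(** Suppose g is not injective, so that the zero map of E is not invertible.  Let
    i : K -> E be the kernel of g and p : E -> C the cokernel of f.  Then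
    f = i f' and g = g' p.  If f' were radical it would factor through f, and left
    minimality would force g = 0; so f' has a retraction r, and dually g' has a
    section s.  The idempotent e = 1 - f' r of K vanishes on f'(T) and therefore
    extends along i to a map t : E -> K, namely e (p i)^-1 (1 - s g') p.  Now
    g (1 - i t) = g makes 1 - i t invertible by right minimality, while it kills
    the image of i e; so e = 0, f' is an isomorphism, and f is a kernel of g. *)
Lemma almost_split_exact T E Y (f : 'Hom(T, E)) (g : 'Hom(E, Y)) :
    left_minimal f -> left_almost_split f ->
    right_minimal g -> right_almost_split g -> (g \o f)%VF = 0 ->
  (forall x, g x = 0 -> x = 0) \/
  (forall X (u : 'Hom(X, E)), is_rhom u -> (g \o u)%VF = 0 ->
     exists v : 'Hom(X, T), is_rhom v /\ u = (f \o v)%VF).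
Proof.
move=> [hf fmin] [rf Ti fas] [hg gmin] [rg Yi gas] gf0.
have [gi|gni] := pselect (forall x, g x = 0 -> x = 0); [by left | right].
have gfE x : g (f x) = 0 by rewrite -comp_lfunE gf0 zero_lfunE.
have E0 : ~ is_riso (0 : 'Hom(E, E)).
  by move=> is0; apply: gni => x _; apply: (riso_ker is0); rewrite zero_lfunE.
(* Were f or g zero, minimality would apply to the zero endomorphism of E. *)
have f0 : f <> 0.
  by move=> f0; apply/E0/fmin; rewrite ?f0 ?comp_lfun0r //; apply: rhom0.
have g0 : g <> 0.
  by move=> g0; apply/E0/gmin; rewrite ?g0 ?comp_lfun0l //; apply: rhom0.
have [K [i [hi ki iK]]] := submodule_inclusion (submodule_ker hg).
have gi0 y : g (i y) = 0.
  by apply/eqP; rewrite -memv_ker -iK memv_img ?memvf.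
have Ki x : g x = 0 -> exists y, i y = x.
  move=> gx0; have : x \in limg i by rewrite iK memv_ker gx0.
  by case/memv_imgP => y _ ->; exists y.
have lift X (u : 'Hom(X, E)) : is_rhom u -> (forall x, g (u x) = 0) ->
    exists u' : 'Hom(X, K), is_rhom u' /\ u = (i \o u')%VF.
  move=> hu gu0; have Ku x : exists y, i y = u x by apply: Ki.
  have [|u' [hu' uE]] := factor_through hi (@rhom1 _ _ K) hu _ Ku.
    by move=> y /ki ->; rewrite linear0.
  exists u'; split=> //; apply/lfunP => x; have [y yx] := Ku x.
  by rewrite comp_lfunE (uE y) // id_lfunE.
have [C [p [hp sp pk]]] := quotient_projection (submodule_img hf).
have pf0 x : p (f x) = 0.
  by apply/eqP; rewrite -memv_ker pk memv_img ?memvf.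
have kpf x : p x = 0 -> exists y, x = f y.
  move=> px0; have : x \in limg f by rewrite -pk memv_ker px0.
  by case/memv_imgP => y _ ->; exists y.
have [f' [hf' fE]] := lift T f hf gfE.
have [||g' [hg' g'E]] := factor_through hp hg (@rhom1 _ _ C).
- by move=> x /kpf[y ->].
- by move=> y; have [x xy] := sp y; exists x; rewrite id_lfunE.
have gE x : g' (p x) = g x by apply: g'E; rewrite id_lfunE.
have [r [hr rf']] : exists r : 'Hom(K, T), is_rhom r /\ (r \o f')%VF = \1%VF.
  apply: nonradical_split_mono => // rf'; have [q [hq f'q]] := fas K f' rf'.
  have isiq : is_riso (i \o q)%VF.
    apply: fmin; first exact: rhom_comp.
    by rewrite -comp_lfunA -f'q.
  have [c [_ _ iqc]] := riso_inv isiq.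
  apply: g0; apply/lfunP => x; rewrite zero_lfunE -[x]id_lfunE -iqc.
  by rewrite -comp_lfunA comp_lfunE gi0.
have [s [hs g's]] : exists s : 'Hom(Y, C), is_rhom s /\ (g' \o s)%VF = \1%VF.
  apply: nonradical_split_epi => // rg'; have [q [hq g'q]] := gas C g' rg'.
  have isqp : is_riso (q \o p)%VF.
    apply: gmin; first exact: rhom_comp.
    by apply/lfunP => x; rewrite comp_lfunA -g'q comp_lfunE gE.
  apply: f0; apply/lfunP => x; rewrite zero_lfunE; apply: (riso_ker isqp).
  by rewrite comp_lfunE pf0 linear0.
pose e : 'Hom(K, K) := \1%VF - (f' \o r)%VF.
have he : is_rhom e by apply: rhomB; [exact: rhom1 | exact: rhom_comp].
have eE y : e y = y - f' (r y) by rewrite add_lfunE opp_lfunE comp_lfunE id_lfunE.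
have ef' x : e (f' x) = 0.
  by rewrite eE -(comp_lfunE r) rf' id_lfunE subrr.
pose z : 'Hom(E, C) := (p - (s \o g))%VF.
have hz : is_rhom z by apply: rhomB => //; apply: rhom_comp.
have zE x : z x = p x - s (g x) by rewrite add_lfunE opp_lfunE comp_lfunE.
have [||t [ht tE]] := factor_through (rhom_comp hp hi) he hz.
- move=> y; rewrite comp_lfunE => /kpf[x yx].
  suff -> : y = f' x by apply: ef'.
  by apply/eqP; rewrite -subr_eq0; apply/eqP/ki; rewrite linearB /= yx fE comp_lfunE subrr.
- move=> x; have [x' px'] := sp (z x).
  have [|y yx] := Ki x'; last by exists y; rewrite comp_lfunE yx.
  rewrite -gE px' zE linearB /= gE -[g' (s _)]comp_lfunE g's id_lfunE subrr //.
have ti y : t (i y) = e y.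
  by apply: tE; rewrite zE gi0 linear0 subr0 comp_lfunE.
pose h : 'Hom(E, E) := \1%VF - (i \o t)%VF.
have hE x : h x = x - i (t x) by rewrite add_lfunE opp_lfunE comp_lfunE id_lfunE.
have ish : is_riso h.
  apply: gmin; first by apply: rhomB; [exact: rhom1 | exact: rhom_comp].
  by apply/lfunP => x; rewrite comp_lfunE hE linearB /= gi0 subr0.
have e0 y : e y = 0.
  have ee : e (e y) = e y by rewrite [X in e X]eE linearB /= ef' subr0.
  by apply: ki; apply: (riso_ker ish); rewrite hE ti ee subrr.
move=> X u hu gu0.
have [|u' [hu' uE]] := lift X u hu; first by move=> x; rewrite -comp_lfunE gu0 zero_lfunE.
exists (r \o u')%VF; split; first exact: rhom_comp.
apply/lfunP => x; rewrite uE fE !comp_lfunE; congr (i _).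
by apply/eqP; rewrite -subr_eq0 -eE e0.
Qed.

End AlmostSplit.

(** * Eigenvalues of endomorphisms *)

Lemma endomorphism_eigenvalue (k : closedFieldType) (V : vectType k) (h : 'End(V)) :
  dim V <> 0%N -> exists c, exists2 x, x != 0 & h x = c *: x.
Proof.
move=> V0; pose e := vbasis {:V}; have eb : basis_of {:V} e by apply: vbasisP.
have [|c rc] := @closed_rootP k (char_poly (passmx.mxof e e h)) _.
  by rewrite size_char_poly dimvf eqSS; apply/eqP.
exists c; have : passmx.leigenspace h c != 0%VS.
  rewrite (passmx.leigenspaceE eb) passmx.vsof_eq0 //.
  by rewrite -[_ != 0]/(eigenvalue _ _) eigenvalue_root_char.
rewrite -vpick0; set x := vpick _ => x0; exists x => //.
have := memv_pick (passmx.leigenspace h c); rewrite -/x memv_ker.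
by rewrite add_lfunE opp_lfunE scale_lfunE id_lfunE subr_eq0 => /eqP.
Qed.

(** * Combinations of images of paths *)

Section PathCombinations.
Variables (k : fieldType) (A : falgType k) (G : AR_component A) (F : mesh_functor G).
Implicit Types x y z : vertex G.

Lemma path_combination_zero n x y : path_combination F n (0 : 'Hom(vmod x, vmod y)).
Proof.
have p (i : 'I_0) : qpath x y by case: i.
by exists 0%N, (fun=> 0), p; split=> [[]|]; rewrite ?big_ord0.
Qed.

Lemma path_combination_path x y (p : qpath x y) :
  path_combination F (qlength p) (Defs.fpath F p).
Proof. by exists 1%N, (fun=> 1), (fun=> p); rewrite big_ord1 scale1r. Qed.

Lemma path_combinationD n x y (f g : 'Hom(vmod x, vmod y)) :
  path_combination F n f -> path_combination F n g -> path_combination F n (f + g).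
Proof.
move=> [m1 [c1 [p1 [l1 ->]]]] [m2 [c2 [p2 [l2 ->]]]].
pose c (o : 'I_m1 + 'I_m2) := match o with inl i => c1 i | inr i => c2 i end.
pose p (o : 'I_m1 + 'I_m2) := match o with inl i => p1 i | inr i => p2 i end.
exists (m1 + m2)%N, (fun i => c (split i)), (fun i => p (split i)).
split=> [i|]; first by case: (split i).
rewrite big_split_ord /=; congr (_ + _); apply: eq_bigr => i _.
  by rewrite -[lshift _ i]/(unsplit (inl i)) unsplitK.
by rewrite -[rshift _ i]/(unsplit (inr i)) unsplitK.
Qed.

Lemma path_combinationZ n x y c (f : 'Hom(vmod x, vmod y)) :
  path_combination F n f -> path_combination F n (c *: f).
Proof.
move=> [m [d [p [l ->]]]]; exists m, (fun i => c * d i), p; split=> //.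
by rewrite scaler_sumr; apply: eq_bigr => i _; rewrite scalerA.
Qed.

Lemma path_combinationB n x y (f g : 'Hom(vmod x, vmod y)) :
  path_combination F n f -> path_combination F n g -> path_combination F n (f - g).
Proof.
by move=> hf hg; rewrite -scaleN1r; apply/path_combinationD/path_combinationZ.
Qed.

Lemma path_combination_sum n x y I (s : seq I) (P : pred I)
    (f : I -> 'Hom(vmod x, vmod y)) :
  (forall i, P i -> path_combination F n (f i)) ->
  path_combination F n (\sum_(i <- s | P i) f i).
Proof.
move=> hf; elim/big_rec: _ => [|i g Pi]; first exact: path_combination_zero.
exact/path_combinationD/hf.
Qed.

Lemma path_combination_arrow n x y z (a : arrow y z) (f : 'Hom(vmod x, vmod y)) :
  path_combination F n f ->
  path_combination F n.+1 (fmor F (arrow_class a) \o f)%VF.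
Proof.
move=> [m [c [p [l ->]]]]; exists m, c, (fun i => qsnoc (p i) a).
split=> [i|]; first by rewrite /= l.
by rewrite comp_lfun_sumr; apply: eq_bigr => i _; rewrite -comp_lfunZr.
Qed.

(** The last arrow of p is one of the a_i; it is carried in a tagged pair so that
    the enumeration of arrows can replace both its source and itself. *)
Lemma path_last_arrow n x y (p : qpath x y) r (z : 'I_r -> vertex G)
    (a : forall i, arrow (z i) y) : all_arrows_to a -> qlength p = n.+1 ->
  exists w : forall i, 'Hom(vmod x, vmod (z i)),
    (forall i, path_combination F n (w i)) /\
    Defs.fpath F p = \sum_i (fmor F (arrow_class (a i)) \o w i)%VF.
Proof.
case: y / p a => [|y' y p' b] a // [inv _ aK] [lp'].
suff split_tag (t : {z & arrow z y}) (q : qpath x (projT1 t)) : qlength q = n ->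
    exists w : forall i, 'Hom(vmod x, vmod (z i)),
    (forall i, path_combination F n (w i)) /\
    (fmor F (arrow_class (projT2 t)) \o Defs.fpath F q)%VF =
      \sum_i (fmor F (arrow_class (a i)) \o w i)%VF.
  exact: (split_tag (existT _ y' b) p').
rewrite -(aK t) /= in q * => lq; set i := inv t in q lq *.
exists (dfwith (T := fun j => 'Hom(vmod x, vmod (z j))) (fun=> 0) (Defs.fpath F q)).
split=> [j|].
  case: dfwithP => [|l _]; last exact: path_combination_zero.
  by rewrite -lq; apply: path_combination_path.
rewrite (bigD1 i) //= dfwith_in big1 ?addr0 // => j ji.
by rewrite dfwith_out 1?eq_sym // comp_lfun0r.
Qed.

Lemma path_combination_last_arrow n x y (f : 'Hom(vmod x, vmod y)) r
    (z : 'I_r -> vertex G) (a : forall i, arrow (z i) y) :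
    all_arrows_to a -> path_combination F n.+1 f ->
  exists w : forall i, 'Hom(vmod x, vmod (z i)),
    (forall i, path_combination F n (w i)) /\
    f = \sum_i (fmor F (arrow_class (a i)) \o w i)%VF.
Proof.
move=> aa [m [c [p [lp ->]]]].
have wP j := path_last_arrow aa (lp j).
pose w j := projT1 (cid (wP j)).
have wE j : (forall i, path_combination F n (w j i)) /\
    Defs.fpath F (p j) = \sum_i (fmor F (arrow_class (a i)) \o w j i)%VF.
  by rewrite /w; case: (cid _).
exists (fun i => \sum_j c j *: w j i); split=> [i|].
  by apply: path_combination_sum => j _; apply: path_combinationZ; case: (wE j).
under [RHS]eq_bigr => i _ do rewrite comp_lfun_sumr.
rewrite exchange_big /=; apply: eq_bigr => j _; case: (wE j) => _ ->.
by rewrite scaler_sumr; apply: eq_bigr => i _; rewrite comp_lfunZr.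
Qed.

(** The value of the functor on any path of length zero from x to y; naming it
    avoids case analysis on the dependent type of paths. *)
Definition trivial_hom x y : 'Hom(vmod x, vmod y) :=
  if pselect (x = y) is left e then ecast t ('Hom(vmod x, vmod t)) e \1%VF else 0.

Lemma trivial_hom1 x : trivial_hom x x = \1%VF.
Proof.
rewrite /trivial_hom; case: pselect => // e.
by rewrite (Prop_irrelevance e erefl).
Qed.

Lemma path_combination0 x y (f : 'Hom(vmod x, vmod y)) :
  path_combination F 0 f -> f = 0 \/ is_riso f.
Proof.
move=> [m [c [p [lp ->{f}]]]].
have fp (q : qpath x y) : qlength q = 0%N -> Defs.fpath F q = trivial_hom x y.
  by case: y / q p lp => [|y' y q b] // *; rewrite trivial_hom1.
rewrite (eq_bigr (fun i => c i *: trivial_hom x y)) => [|i _]; last by rewrite fp.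
rewrite -scaler_suml; set d := \sum_i c i.
have [->|d0] := eqVneq d 0; first by left; rewrite scale0r.
have [e|nxy] := pselect (x = y).
  by right; apply: risoZ => //; case: y / e {p lp fp}; rewrite trivial_hom1; apply: riso1.
by left; rewrite /trivial_hom; case: pselect => //; rewrite scaler0.
Qed.

Lemma fmorD x y (u v : mesh_hom x y) : fmor F (u + v) = fmor F u + fmor F v.
Proof. by rewrite -[u]scale1r fmor_linear !scale1r. Qed.

Lemma fmor0 x y : fmor F (0 : mesh_hom x y) = 0.
Proof. by apply: (@addrI _ (fmor F (0 : mesh_hom x y))); rewrite -fmorD !addr0. Qed.

Lemma mesh_class0 x y : mesh_class (0 : path_hom x y) = 0.
Proof.
by apply: (@addrI _ (mesh_class (0 : path_hom x y))); rewrite -mesh_classD !addr0.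
Qed.

Lemma mesh_relation x (px : ~ projective (vmod x)) r (y : 'I_r -> vertex G)
    (a : forall i, arrow (y i) x) : all_arrows_to a ->
  \sum_i (fmor F (arrow_class (a i)) \o fmor F (arrow_class (sigma px (a i))))%VF = 0.
Proof.
move=> aa; have := mesh_rel px aa; set u := \sum_i _ => Iu.
have u0 : mesh_class u = 0.
  by rewrite -mesh_class0; apply/mesh_classP; rewrite subr0.
rewrite -[RHS](fmor0 (tau px) x) -u0.
rewrite (big_morph _ (@mesh_classD _ _ G (tau px) x) (mesh_class0 _ _)).
rewrite (big_morph _ (@fmorD _ _) (fmor0 _ _)).
by apply: eq_bigr => i _; rewrite -mesh_compE fmor_comp.
Qed.

Lemma all_arrows_sigma x (px : ~ projective (vmod x)) r (y : 'I_r -> vertex G)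
    (a : forall i, arrow (y i) x) : all_arrows_to a ->
  all_arrows_from (fun i => sigma px (a i)).
Proof.
move=> aa; pose S (t : {z & arrow z x}) : {z & arrow (tau px) z} :=
  existT _ (projT1 t) (sigma px (projT2 t)).
suff bS : bijective S by exact: bij_comp bS aa.
have invP z : exists g, cancel (@sigma _ _ G x px z) g /\ cancel g (@sigma _ _ G x px z).
  by have [g gK Kg] := sigma_bij px z; exists g.
pose g z := projT1 (cid (invP z)).
have gP z : cancel (@sigma _ _ G x px z) (g z) /\ cancel (g z) (@sigma _ _ G x px z).
  by rewrite /g; case: (cid _).
exists (fun t => existT _ (projT1 t) (g _ (projT2 t))) => [[z b]|[z b]]; rewrite /S /=.
  by rewrite (gP z).1.
by rewrite (gP z).2.
Qed.

End PathCombinations.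

(** * Meshes as exact sequences *)

Section MeshComparable.
Variables (k : fieldType) (A : falgType k) (G : AR_component A) (F : mesh_functor G).
Hypothesis RF : Riedtmann F.
Implicit Types x y z : vertex G.

Lemma arrow_radical x y (a : arrow x y) : radical (fmor F (arrow_class a)).
Proof.
have [r [z [b ab]]] := locally_finite_in y.
have [_ [rg _ _]] := RF.2 y r z b ab; case: ab => inv _ bK.
suff tagged_radical (t : {z & arrow z y}) : radical (fmor F (arrow_class (projT2 t))).
  exact: (tagged_radical (existT _ x a)).
rewrite -(bK t) /= -(dsum_row_inj (fun i => fmor F (arrow_class (b i)))).
exact: radical_compr rg (@rhom_dsum_inj _ _ _ _ _).
Qed.

Lemma path_combination_rad n x y (f : 'Hom(vmod x, vmod y)) :
  path_combination F n f -> rad_pow n f.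
Proof.
move=> [m [c [p [lp ->]]]]; apply: rad_pow_sum => i _; apply: rad_powZ.
rewrite -(lp i); elim: (p i) => /= [|z t q IHq b]; first exact: rhom1.
by apply: rad_powSl IHq; apply: arrow_radical.
Qed.

Lemma rad_pow_last_arrow x y r (z : 'I_r -> vertex G) (a : forall i, arrow (z i) y) n
    (f : 'Hom(vmod x, vmod y)) : all_arrows_to a -> rad_pow n.+1 f ->
  exists u : forall i, 'Hom(vmod x, vmod (z i)),
    (forall i, rad_pow n (u i)) /\
    f = \sum_i (fmor F (arrow_class (a i)) \o u i)%VF.
Proof.
move=> aa nf; have [_ gas] := RF.2 y r z a aa.
have [u [nu ->]] := rad_pow_factor_right gas nf.
exists (fun i => dsum_proj i \o u)%VF; split=> [i|].
  exact: rad_pow_compl (@rhom_dsum_proj _ _ _ _ i) nu.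
by rewrite {1}(dsum_col_proj u) dsum_row_col.
Qed.

(** If y is projective the row g of the maps F(a_i) is not onto, since it would
    split and be radical, so it is injective.  Otherwise the column of the maps
    F(sigma a_i) is left almost split and composes with g to zero by the mesh
    relation, and the pair is exact unless g is injective. *)
Lemma mesh_kernel x y r (z : 'I_r -> vertex G) (a : forall i, arrow (z i) y)
    (u : forall i, 'Hom(vmod x, vmod (z i))) : all_arrows_to a ->
    (forall i, is_rhom (u i)) ->
    \sum_i (fmor F (arrow_class (a i)) \o u i)%VF = 0 ->
  (forall i, u i = 0) \/
  exists (py : ~ projective (vmod y)) (v : 'Hom(vmod x, vmod (tau py))),
    is_rhom v /\ forall i, u i = (fmor F (arrow_class (sigma py (a i))) \o v)%VF.
Proof.
move=> aa hu; have [gmin gas] := RF.2 y r z a aa; move: gmin gas => /=.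
set g := dsum_row _ => gmin gas gu0.
have gcol : (g \o dsum_col u = 0)%VF by rewrite dsum_row_col.
have hcol : is_rhom (dsum_col u) by apply: rhom_dsum_col.
have inj_case : (forall e, g e = 0 -> e = 0) -> forall i, u i = 0.
  move=> gi i; rewrite -(dsum_proj_col u) [dsum_col u](_ : _ = 0) ?comp_lfun0r //.
  by apply/lfunP => e; rewrite zero_lfunE; apply: gi; rewrite -comp_lfunE gcol zero_lfunE.
have [py|py] := pselect (projective (vmod y)).
  left; apply: inj_case.
  have [gs|//] := right_minimal_almost_split_cases gmin gas.
  have [s [hs gs1]] := py _ _ g \1%VF gmin.1 gs (@rhom1 _ _ _).
  have [rg yi _] := gas; case: (radical_not_riso yi yi (radical_compr rg hs)).
  by rewrite -gs1; apply: riso1.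
have [fmin fas] := RF.1 _ _ _ _ (all_arrows_sigma py aa).
have gf0 : (g \o dsum_col (fun i => fmor F (arrow_class (sigma py (a i)))))%VF = 0.
  by rewrite dsum_row_col mesh_relation.
have [gi|exact_g] := almost_split_exact fmin fas gmin gas gf0; first by left; apply: inj_case.
right; have [v [hv uE]] := exact_g _ _ hcol gcol.
exists py, v; split=> // i.
by rewrite -(dsum_proj_col u) uE comp_lfunA dsum_proj_col.
Qed.

End MeshComparable.

(** * Existence and uniqueness of the expansion *)

Section Decompositions.
Variables (k : closedFieldType) (A : falgType k) (G : AR_component A) (F : mesh_functor G).
Hypothesis RF : Riedtmann F.
Implicit Types x y z : vertex G.

(** A nonradical map between vertices is an automorphism of one of them; as k is
    algebraically closed it has an eigenvalue c, and f - c is not invertible, hence radical. *)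
Lemma degree0_part x y (f : 'Hom(vmod x, vmod y)) : is_rhom f ->
  exists f0, path_combination F 0 f0 /\ radical (f - f0).
Proof.
move=> hf; have [rf|isf] := radical_indec (vmod_indec x) (vmod_indec y) hf.
  by exists 0; rewrite subr0; split=> //; apply: path_combination_zero.
have e : x = y by apply: vmod_inj; exists f.
case: y / e f hf isf => f hf _.
have [xd _] := vmod_indec x; rewrite dimvf in xd.
have [c [v v0 fv]] := endomorphism_eigenvalue f xd.
have h1 := @rhom1 _ _ (vmod x).
exists (c *: \1%VF); split.
  by apply: path_combinationZ; apply: (path_combination_path F (qnil x)).
have hfc := rhomB hf (rhomZ c h1).
have [//|isfc] := radical_indec (vmod_indec x) (vmod_indec x) hfc.
case/eqP: v0; apply: (riso_ker isfc).
by rewrite add_lfunE opp_lfunE scale_lfunE id_lfunE fv subrr.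
Qed.

(** Split off the scalar part, factor the radical rest through the arrows ending
    at y, and expand each factor to one degree less. *)
Lemma finite_expansion n x y (f : 'Hom(vmod x, vmod y)) : is_rhom f ->
  exists (v : nat -> 'Hom(vmod x, vmod y)) (h : 'Hom(vmod x, vmod y)),
    [/\ forall j, path_combination F j (v j), rad_pow n h
      & f = \sum_(j < n) v j + h].
Proof.
elim: n y f => [|n IHn] y f hf.
  exists (fun=> 0), f; rewrite big_ord0 add0r; split=> // j.
  exact: path_combination_zero.
have [f0 [pf0 rf]] := degree0_part hf.
have [r [z [a aa]]] := locally_finite_in y.
have [u [hu fE]] := rad_pow_last_arrow RF (n := 0) aa rf.
have uP i := IHn _ (u i) (hu i).
pose v i := projT1 (cid (uP i)).
have vP i : exists h : 'Hom(vmod x, vmod (z i)),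
      [/\ forall j, path_combination F j (v i j), rad_pow n h
        & u i = \sum_(j < n) v i j + h] by rewrite /v; case: (cid _).
pose h i := projT1 (cid (vP i)).
have hP i : [/\ forall j, path_combination F j (v i j), rad_pow n (h i)
      & u i = \sum_(j < n) v i j + h i] by rewrite /h; case: (cid _).
exists (fun j => if j is j'.+1 then \sum_i (fmor F (arrow_class (a i)) \o v i j')%VF else f0).
exists (\sum_i (fmor F (arrow_class (a i)) \o h i)%VF); split=> [[|j] //||].
- apply: path_combination_sum => i _; apply: path_combination_arrow.
  by case: (hP i).
- apply: rad_pow_sum => i _; apply: rad_powSl; first exact: arrow_radical.
  by case: (hP i).
rewrite big_ord_recl /= -addrA -[LHS](subrK f0) [LHS]addrC; congr (_ + _); rewrite fE.
rewrite exchange_big -big_split /=; apply: eq_bigr => i _.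
have [_ _ uE] := hP i; rewrite [in LHS]uE comp_lfunDr comp_lfun_sumr.
by congr (_ + _); apply: eq_bigr.
Qed.

(** The functor induced by F from paths graded by length to the graded category of
    the radical filtration has, in degree n, no kernel beyond that of F. *)
Definition graded_faithful n := forall x y (f : 'Hom(vmod x, vmod y)),
  path_combination F n f -> rad_pow n.+1 f -> f = 0.

(** Terms of degree at least j + 1 lie in rad^(j+1), so the parts vanish one
    after the other, from the lowest degree upwards. *)
Lemma homogeneous_parts_zero N x y (d : nat -> 'Hom(vmod x, vmod y)) :
    (forall n, (n < N)%N -> graded_faithful n) ->
    (forall j, path_combination F j (d j)) ->
    rad_pow N (\sum_(j < N) d j) ->
  forall j, (j < N)%N -> d j = 0.
Proof.
move=> KN pd; elim: N KN => // N IHN KN rd.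
have dN := path_combination_rad RF (pd N).
move: rd; rewrite big_ord_recr /= => rd.
have lt0 j : (j < N)%N -> d j = 0.
  apply: IHN => [n /ltnW ltn|]; first exact: KN.
  by rewrite -[X in rad_pow _ X](addrK (d N)); apply: rad_powB => //; apply: rad_pow_pred.
have d0 : d N = 0.
  apply: (KN N) => //; move: rd; rewrite big1 ?add0r // => j _; exact: lt0.
by move=> j; rewrite ltnS leq_eqVlt => /orP[/eqP-> | /lt0].
Qed.

(** Write f = sum F(a_i) w_i over the arrows a_i ending at y, with w_i of degree
    n, and also f = sum F(a_i) u_i with u_i in rad^(n+1).  The difference w - u
    is killed by the row of the F(a_i), so either w = u, and induction applies
    directly, or w_i - u_i = F(sigma a_i) v for some v.  Expanding v, the
    homogeneous parts of w_i - F(sigma a_i) v in degrees up to n are zero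
    by induction; in degree n this reads w_i = F(sigma a_i) v_(n-1), and the mesh
    relation gives f = 0. *)
Lemma graded_faithfulness n : graded_faithful n.
Proof.
elim/ltn_ind: n => -[_|n IHn] x y f pf rf.
  case: (path_combination0 pf) => // isf.
  by case: (radical_not_riso (vmod_indec x) (vmod_indec y) rf).
have [r [z [a aa]]] := locally_finite_in y.
have [w [pw fw]] := path_combination_last_arrow aa pf.
have [u [ru fu]] := rad_pow_last_arrow RF aa rf.
have hw i : is_rhom (w i) by apply: rad_pow_rhom (path_combination_rad RF (pw i)).
have hu i : is_rhom (u i) by apply: rad_pow_rhom (ru i).
have wu0 : \sum_i (fmor F (arrow_class (a i)) \o (w i - u i))%VF = 0.
  under eq_bigr => i _ do rewrite comp_lfunDr comp_lfunNr.
  by rewrite sumrB -fw -fu subrr.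
have hwu i : is_rhom (w i - u i) by apply: rhomB.
have [wu|[py [v [hv wu]]]] := mesh_kernel RF aa hwu wu0.
  rewrite fw big1 // => i _; rewrite (IHn n _ _ _ (w i)) ?comp_lfun0r //.
  by have /eqP := wu i; rewrite subr_eq0 => /eqP->.
have [vj [h [pv rh vE]]] := finite_expansion n hv.
pose s i := fmor F (arrow_class (sigma py (a i))).
(* The homogeneous parts of w_i - F(sigma a_i) v: composing with an arrow raises
   the degree of the parts of v by one. *)
pose d i j := (if j == n then w i else 0) - (if j is j'.+1 then s i \o vj j' else 0)%VF.
have pd i j : path_combination F j (d i j).
  apply: path_combinationB.
    by case: eqP => [->|_] //; apply: path_combination_zero.
  by case: j => [|j]; [apply: path_combination_zero | apply: path_combination_arrow].
have sum_d i : \sum_(j < n.+1) d i j = u i + (s i \o h)%VF.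
  rewrite sumrB big_ord_recr big_ord_recl /= eqxx big1 ?add0r => [|j _]; last first.
    by rewrite ltn_eqF.
  have /eqP := wu i; rewrite subr_eq addrC => /eqP->.
  rewrite -addrA vE comp_lfunDr comp_lfun_sumr; congr (_ + _).
  by rewrite addrAC subrr add0r.
have rd i : rad_pow n.+1 (\sum_(j < n.+1) d i j).
  by rewrite sum_d; apply: rad_powD (ru i) (rad_powSl (arrow_radical RF _) rh).
have dn i : d i n = 0 by apply: (homogeneous_parts_zero IHn (pd i) (rd i)).
have wE i : w i = (if n is m.+1 then s i \o vj m else 0)%VF.
  by have /eqP := dn i; rewrite /d eqxx subr_eq0 => /eqP.
rewrite fw; case: (n) wE => [|m] wE.
  by rewrite big1 // => i _; rewrite wE comp_lfun0r.
under eq_bigr => i _ do rewrite wE comp_lfunA.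
by rewrite -comp_lfun_suml mesh_relation // comp_lfun0l.
Qed.

Lemma sum_finite_support (V : zmodType) (d : nat -> V) N M :
  (forall n, (N <= n)%N -> d n = 0) -> (N <= M)%N ->
  \sum_(n < M) d n = \sum_(n < N) d n.
Proof.
move=> dN leNM; rewrite -(subnKC leNM) big_split_ord /= [X in _ + X]big1 ?addr0 // => i _.
by rewrite dN // leq_addr.
Qed.

(** Past the degree where the radical filtration of Hom(x, y) has stabilised,
    the remainder of the expansion lies in the infinite radical. *)
Lemma decomposition_exists x y (f : 'Hom(vmod x, vmod y)) : is_rhom f ->
  exists fn finf, is_decomposition F f fn finf /\ path_combination F 0 (fn 0%N).
Proof.
move=> hf; have [N radN] := rad_pow_stable (vmod x) (vmod y).
have [v [h [pv rh fE]]] := finite_expansion N hf.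
pose fn n := if (n < N)%N then v n else 0.
have pfn n : path_combination F n (fn n).
  by rewrite /fn; case: ifP => // _; apply: path_combination_zero.
exists fn, h; split=> //; split; last exact: radN.
- exists N; split=> [n|]; first by rewrite /fn ltnNge => ->.
  by rewrite fE; congr (_ + _); apply: eq_bigr => j _; rewrite /fn ltn_ord.
- exact: path_combination0 (pfn 0%N).
- by right.
Qed.

(** The difference of two expansions is a finite sum of homogeneous parts lying in
    the infinite radical, so [homogeneous_parts_zero] applies. *)
Lemma decomposition_unique x y (f : 'Hom(vmod x, vmod y)) fn finf gn ginf :
    is_decomposition F f fn finf -> path_combination F 0 (fn 0%N) ->
    is_decomposition F f gn ginf -> path_combination F 0 (gn 0%N) ->
  (forall n, fn n = gn n) /\ finf = ginf.
Proof.
move=> [[N1 [fN fE]] _ pf rf] pf0 [[N2 [gN gE]] _ pg rg] pg0.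
pose d n := fn n - gn n.
have pd n : path_combination F n (d n).
  case: n => [|n]; first exact: path_combinationB.
  apply: path_combinationB; [case: (pf n.+1) | case: (pg n.+1)] => // ->;
  exact: path_combination_zero.
pose N := maxn N1 N2.
have sumE : \sum_(n < N) d n = ginf - finf.
  rewrite sumrB (sum_finite_support fN) ?leq_maxl // (sum_finite_support gN) ?leq_maxr //.
  have -> : \sum_(n < N1) fn n = f - finf by rewrite fE addrK.
  have -> : \sum_(n < N2) gn n = f - ginf by rewrite gE addrK.
  by rewrite opprB addrC addrA subrK.
have d0 n : (n < N)%N -> d n = 0.
  apply: (homogeneous_parts_zero (N := N) (fun m _ => @graded_faithfulness m) pd).
  by rewrite sumE; apply: rad_powB.
have fg n : fn n = gn n.
  have [/d0/eqP|] := ltnP n N; first by rewrite subr_eq0 => /eqP.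
  by rewrite geq_max => /andP[/fN -> /gN ->].
split=> //; apply/esym/eqP; rewrite -subr_eq0 -sumE big1 // => n _; exact: d0.
Qed.

End Decompositions.

Local Close Scope ring_scope.

(* The clause "f_0 is zero or an isomorphism" alone does not give uniqueness
   (over k[x]/(x^2), the identity of the free module A is both f_0 = 1 and
   f_0 = 1 + x, f_2 = - x), so f_0 is moreover required to be a linear
   combination of images of paths of length 0, that is a scalar multiple of the
   identity if X = Y and zero otherwise. *)
Theorem proposition3p2 (k : closedFieldType) (A : falgType k)
    (Gamma : AR_component A) (F : mesh_functor Gamma)
    (hF : mesh_comparable F) (X Y : vertex Gamma)
    (f : 'Hom(vmod X, vmod Y)) (hf : is_rhom f) :
  exists (fn : nat -> 'Hom(vmod X, vmod Y)) (finf : 'Hom(vmod X, vmod Y)),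
    [/\ is_decomposition F f fn finf,
        path_combination F 0 (fn 0)
      & forall (gn : nat -> 'Hom(vmod X, vmod Y)) (ginf : 'Hom(vmod X, vmod Y)),
          is_decomposition F f gn ginf -> path_combination F 0 (gn 0) ->
          (forall n, fn n = gn n) /\ finf = ginf].
Proof.
have [fn [finf [dec pf0]]] := decomposition_exists hF hf.
exists fn, finf; split=> // gn ginf decg pg0.
exact: (decomposition_unique hF dec pf0 decg pg0).
Qed.
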